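(* Let $r\ge 1$ be an integer and let $$\rho(z)=\rho_0+\rho_1 z+\cdots+\rho_r z^r,\qquad \sigma(z)=\sigma_0+\sigma_1 z+\cdots+\sigma_r z^r$$ be two relatively prime real polynomials of degree $r$, with $\rho_r\sigma_r\neq 0$. Let $\lambda(z)=\lambda_0+\lambda_1 z+\cdots+\lambda_r z^r$ be a nonzero real polynomial of degree at most $r$, and let $\gamma\ge 0$ be a constant. Then the following statements are equivalent: (i) $\operatorname{Re}\left\{\dfrac{\rho(z)}{\sigma(z)}\right\}>\gamma\left|\dfrac{\lambda(z)}{\sigma(z)}\right|^2$ for all $z\in\mathbb{C}$ with $|z|>1$. (ii) $\operatorname{Re}\{\rho(z)\sigma(\bar z)\}\ge\gamma|\lambda(z)|^2$ for all $z\in\mathbb{C}$ with $|z|\ge 1$. (iii) All three of the following hold: (a) $\sigma(z)\neq 0$ for all $|z|>1$; (b) $\operatorname{Re}\{\rho(z)\sigma(\bar z)\}\ge\gamma|\lambda(z)|^2$ for all $|z|=1$; (c) if $z_0$ is a root of $\sigma$ with $|z_0|=1$, then $z_0$ is a simple root and $\dfrac{\rho(z_0)}{\sigma'(z_0)}\bar z_0>0$ (i.e. this number is real and positive). (iv) There exist $r$ linearly independent polynomials $p_1,\ldots,p_r$ and a polynomial $q$, all with real coefficients, with $\deg p_j\le r-1$ for each $j$ and $\deg q\le r$, such that for all $z,w\in\mathbb{C}$, $$\rho(z)\sigma(w)+\rho(w)\sigma(z)-2\gamma\lambda(z)\lambda(w)=q(z)q(w)+(zw-1)\sum_{j=1}^r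 p_j(z)p_j(w).$$ (v) There exist a vector $\boldsymbol{q}=[q_r,\ldots,q_0]^\top\in\mathbb{R}^{r+1}$ and a positive definite matrix $G\in\mathbb{R}^{r\times r}$ such that $$\boldsymbol{\rho}\boldsymbol{\sigma}^\top+\boldsymbol{\sigma}\boldsymbol{\rho}^\top-2\gamma\boldsymbol{\lambda}\boldsymbol{\lambda}^\top=\boldsymbol{q}\boldsymbol{q}^\top+\begin{bmatrix}G&\boldsymbol{0}_r\\ \boldsymbol{0}_r^\top&0\end{bmatrix}-\begin{bmatrix}0&\boldsymbol{0}_r^\top\\ \boldsymbol{0}_r&G\end{bmatrix},$$ where $\boldsymbol{\rho},\boldsymbol{\sigma},\boldsymbol{\lambda}$ are the coefficient vectors of $\rho,\sigma,\lambda$.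
   Context: For a polynomial $\pi(z)=\sum_{j=0}^r\pi_j z^j$, its coefficient vector is $\boldsymbol{\pi}=[\pi_r,\pi_{r-1},\ldots,\pi_0]^\top\in\mathbb{R}^{r+1}$ (highest-degree coefficient first; for $\lambda$ of degree less than $r$ the leading entries are zero). $\boldsymbol{0}_m$ is the zero vector in $\mathbb{R}^m$. Positive definite matrices are understood to be real symmetric. *)

(* Defs.v *)
From HB Require Import structures.
From mathcomp Require Export all_boot all_order all_algebra.
From mathcomp Require Export complex reals.

Set Implicit Arguments.
Unset Strict Implicit.
Unset Printing Implicit Defensive.

Import Order.TTheory GRing.Theory Num.Theory.
Local Open Scope ring_scope.

(* Values in R[i] are compared with the partial order of R[i], in which x < y   *)
(* means that y - x is real and positive; norms `|z| and real parts 'Re z are   *)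
(* elements of R[i] lying on the real axis.                                     *)
Definition toC (R : realType) (x : R) : R[i] := real_complex R x.

Definition polyC_of (R : realType) (p : {poly R}) : {poly R[i]} :=
  map_poly (real_complex R) p.

Definition evalC (R : realType) (p : {poly R}) (z : R[i]) : R[i] :=
  (polyC_of p).[z].

(* Highest-degree coefficient first; used for p of degree at most r. *)
Definition coefvec (R : realType) (r : nat) (p : {poly R}) : 'cV[R]_r.+1 :=
  \col_(i < r.+1) p`_(r - i).

Definition posdefmx (R : realType) (n : nat) (G : 'M[R]_n) : Prop :=
  G^T = G /\ forall x : 'cV[R]_n, x != 0 -> 0 < (x^T *m G *m x) 0 0.

(* The cast is needed because block_mx G 0 0 0 has dimension r + 1, which is    *)
(* not convertible to r.+1 (whereas 1 + r is).                                  *)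
Definition bordered_br (R : realType) (r : nat) (G : 'M[R]_r) : 'M[R]_r.+1 :=
  castmx (addn1 r, addn1 r) (block_mx G 0 0 (0 : 'M[R]_1)).

Definition bordered_ul (R : realType) (r : nat) (G : 'M[R]_r) : 'M[R]_r.+1 :=
  block_mx (0 : 'M[R]_1) 0 0 G.

(* Main.v *)
Require Import Defs.
From mathcomp Require Import all_classical topology normedtype sequences.
From mathcomp Require Import lra ring zify.

(** Conditions (iv) and (v) are the same identity, read on polynomials or on
their coefficients: a positive definite G is a sum of p_j p_j^T with independent
p_j by Cholesky factorization ([squares_of_kernel], [matrix_of_squares],
[squares_of_matrix]). Setting w = conj z in (iv) gives (i)
([strict_of_squares]). From (i) one gets (ii) by continuity, and (iii) follows
from (ii) by looking at the leading term of rho conj(sigma) near a zero of sigma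
([no_root_outside], [boundary_root_simple]): it would otherwise have a negative
real part in some direction that does not enter the disc.

The heart is the passage from (iii) to (iv) ([squares_of_boundary]). Suppose
first that sigma has all its roots in the open disc and that the inequality (b)
is strict. The theorem of Fejer and Riesz ([fejer_riesz]) provides a real q such
that rho(z) sigma(w) + rho(w) sigma(z) - 2 gamma lambda(z) lambda(w) - q(z) q(w)
vanishes for z w = 1, so that it is (z w - 1) g(z, w) for a symmetric kernel g.
Let L be a functional on polynomials that vanishes on the multiples of sigma.
Applying L to z^n w^n times the identity in both variables shows that the
values of g on the shifted functionals p |-> L(z^n p) decrease with n; these
functionals tend to 0 because the roots of sigma are in the open disc, so the
values are nonnegative, that is, g is positive semidefinite ([psd_of_stable]).

In general, replace rho and sigma by rho + e sigma and sigma + e rho with e > 0.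
Coprimality makes (b) strict, and condition (c) makes the roots of sigma on the
circle move inwards for small e ([perturbed_stable]). The factors q stay
bounded, so a subsequence converges as e tends to 0 ([spectral_limit],
[boundary_spectral]), and a semidefinite kernel g is obtained for rho and sigma
themselves. Finally g is definite: a functional in its kernel, extended to
vanish on the multiples of sigma, also vanishes on the multiples of rho, hence
on everything, as rho and sigma are coprime ([pd_of_psd]). *)

Set Implicit Arguments.
Unset Strict Implicit.
Unset Printing Implicit Defensive.

Import Order.TTheory GRing.Theory Num.Theory.
Import numFieldNormedType.Exports.
Local Open Scope ring_scope.

(** * Bivariate kernels and multiplication by z w - 1 *)

(** Kernels are functions of two natural numbers, standing for the coefficient
of z^i w^j; [shift_kernel r g] is (z w - 1) g truncated to i, j <= r. Working
with coefficients rather than with bivariate polynomials lets the monomials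
z^i, w^j be replaced by arbitrary sequences [u i], [v j], which is how linear
functionals are applied to the kernel identity below. *)
Section DisplacementKernels.
Variable K : comNzRingType.
Implicit Types (h g : nat -> nat -> K) (a b l q : nat -> K) (r : nat).

Definition shift_kernel r g (i j : nat) : K :=
  (if (0 < i)%N && (0 < j)%N then g i.-1 j.-1 else 0)
  - (if (i < r)%N && (j < r)%N then g i j else 0).

(** The left-hand side of (iv) minus q(z) q(w), with [a], [b], [l] the
coefficients of rho, sigma, lambda and [c] = 2 gamma. *)
Definition residual_kernel a b l (c : K) q (i j : nat) : K :=
  a i * b j + b i * a j - c * l i * l j - q i * q j.

(** The formal quotient of [h] by z w - 1: expanding - h / (1 - z w) as a
geometric series sums [h] down the diagonals. *)
Definition diagsum h (i j : nat) : K :=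
  - \sum_(k < (minn i j).+1) h (i - k)%N (j - k)%N.

Lemma diagsum_sym h : (forall i j, h i j = h j i) ->
  forall i j, diagsum h i j = diagsum h j i.
Proof. by move=> hs i j; rewrite /diagsum minnC; under eq_bigr do rewrite hs. Qed.

(** The power series quotient is a polynomial of degree less than r in each
variable exactly when its terms with i = r vanish; this says that h(z, 1/z) = 0,
the condition under which z w - 1 divides [h]. *)
Lemma diagsum_shift_kernel r h : (forall i j, h i j = h j i) ->
  (forall j, (j <= r)%N -> diagsum h r j = 0) ->
  forall i j, (i <= r)%N -> (j <= r)%N -> h i j = shift_kernel r (diagsum h) i j.
Proof.
move=> hs h0 i j ir jr; rewrite /shift_kernel.
have -> : (if (i < r)%N && (j < r)%N then diagsum h i j else 0) = diagsum h i j.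
  case: (ltnP i r) => [ir'|ri] /=; last first.
    have -> : i = r by apply/eqP; rewrite eqn_leq ir ri.
    by rewrite h0.
  case: (ltnP j r) => // rj /=.
  by have -> : j = r; [apply/eqP; rewrite eqn_leq jr rj | rewrite diagsum_sym ?h0].
case: i j {ir jr} => [|i] [|j] /=.
- by rewrite /diagsum minn0 big_ord1 sub0r opprK.
- by rewrite /diagsum min0n big_ord1 sub0r opprK.
- by rewrite /diagsum minn0 big_ord1 sub0r opprK.
rewrite /diagsum minnSS [in X in _ - X]big_ord_recl /= opprK.
under [X in _ = _ + (_ + X)]eq_bigr do rewrite /bump /= !subSS.
by ring.
Qed.

Lemma residual_kernel_sym a b l c q i j : residual_kernel a b l c q i j = residual_kernel a b l c q j i.
Proof. by rewrite /residual_kernel; ring. Qed.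

Lemma sum_shift_kernel r g (u v : nat -> K) :
  \sum_(i < r.+1) \sum_(j < r.+1) shift_kernel r g i j * (u i * v j)
  = \sum_(i < r) \sum_(j < r) g i j * (u i.+1 * v j.+1 - u i * v j).
Proof.
transitivity (\sum_(i < r.+1) \sum_(j < r.+1)
   (if (0 < i)%N && (0 < j)%N then g i.-1 j.-1 else 0) * (u i * v j)
  - \sum_(i < r.+1) \sum_(j < r.+1)
   (if (i < r)%N && (j < r)%N then g i j else 0) * (u i * v j)).
  rewrite -sumrB; apply: eq_bigr => i _; rewrite -sumrB.
  by apply: eq_bigr => j _; rewrite -mulrBl.
rewrite [X in X - _]big_ord_recl [X in _ - X]big_ord_recr /=.
rewrite [X in X + _ - _]big1 => [|i _]; last by rewrite mul0r.
rewrite [X in _ - (_ + X)]big1 => [|i _]; last by rewrite ltnn mul0r.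
rewrite add0r addr0 -sumrB; apply: eq_bigr => i _.
rewrite big_ord_recl [X in _ - X]big_ord_recr /= ltnn andbF !mul0r add0r addr0.
rewrite -sumrB; apply: eq_bigr => j _.
by rewrite /bump /= !add1n !ltn_ord /= -mulrBr.
Qed.

End DisplacementKernels.

Lemma residual_kernel_sum (A B : comNzRingType) (f : {rmorphism A -> B}) (r : nat)
    (a b l q : nat -> A) (c : A) (u v : nat -> B) :
  let L p w := \sum_(i < r.+1) f (p (i : nat)) * w (i : nat) in
  \sum_(i < r.+1) \sum_(j < r.+1) f (residual_kernel a b l c q i j) * (u i * v j) =
  L a u * L b v + L b u * L a v - f c * L l u * L l v - L q u * L q v.
Proof.
move=> L; rewrite -(mulrA (f c)) /L !big_distrlr /= mulr_sumr.
rewrite -big_split -!sumrB /=; apply: eq_bigr => i _.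
rewrite mulr_sumr -big_split -!sumrB /=; apply: eq_bigr => j _.
by rewrite /residual_kernel !(rmorphB, rmorphD, rmorphM) /=; ring.
Qed.

(** Applying the functional z^i |-> u i in the first variable and w^j |-> v j in
the second one; multiplication by z w - 1 becomes the shift of both
sequences. *)
Lemma kernel_eval (A B : comNzRingType) (f : {rmorphism A -> B}) (r : nat)
    (a b l q : nat -> A) (c : A) (g : nat -> nat -> A) :
  (forall i j, (i <= r)%N -> (j <= r)%N ->
     residual_kernel a b l c q i j
    = shift_kernel r g i j) ->
  let L p w := \sum_(i < r.+1) f (p (i : nat)) * w (i : nat) in
  forall u v : nat -> B,
  L a u * L b v + L b u * L a v - f c * L l u * L l v - L q u * L q v
  = \sum_(i < r) \sum_(j < r) f (g i j) * (u i.+1 * v j.+1 - u i * v j).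
Proof.
move=> hg L u v; rewrite /L -residual_kernel_sum -(sum_shift_kernel r (fun i j => f (g i j))).
apply: eq_bigr => i _; apply: eq_bigr => j _.
rewrite (hg i j (ltn_ord i) (ltn_ord j)) /shift_kernel rmorphB.
by do 2 case: ifP => _; rewrite ?rmorph0.
Qed.

(** * A real-valued modulus *)
Section Modulus.
Variable R : realType.
Implicit Types z w : R[i].

Definition cabs z : R := complex.Re `|z|.

Lemma cabsE z : `|z| = toC (cabs z).
Proof. by rewrite /cabs /toC normc_def. Qed.

Lemma cabsM z w : cabs (z * w) = cabs z * cabs w.
Proof.
by apply: complexI; rewrite -/(toC _) -cabsE normrM !cabsE /toC -rmorphM.
Qed.

Lemma cabsD z w : cabs (z + w) <= cabs z + cabs w.
Proof.
rewrite -lecR rmorphD /=; have := ler_normD z w.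
by rewrite !cabsE.
Qed.

Lemma cabs_ge0 z : 0 <= cabs z.
Proof. by rewrite -lecR -/(toC (cabs z)) -cabsE normr_ge0. Qed.

Lemma cabs_eq0 z : (cabs z == 0) = (z == 0).
Proof. by rewrite -(inj_eq (@complexI R)) -/(toC (cabs z)) -cabsE normr_eq0. Qed.

Lemma cabs_gt0 z : (0 < cabs z) = (z != 0).
Proof. by rewrite lt0r cabs_eq0 cabs_ge0 andbT. Qed.

Lemma cabsN z : cabs (- z) = cabs z.
Proof. by rewrite /cabs normrN. Qed.

Lemma cabs0 : cabs 0 = 0. Proof. by apply/eqP; rewrite cabs_eq0. Qed.

Lemma cabs_toC (x : R) : cabs (toC x) = `|x|.
Proof. by rewrite /cabs normc_def /= expr0n addr0 sqrtr_sqr. Qed.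

Lemma cabs1 : cabs 1 = 1. Proof. by rewrite /cabs normr1. Qed.

Lemma cabsX z n : cabs (z ^+ n) = cabs z ^+ n.
Proof. by elim: n => [|n IH]; rewrite ?cabs1 // !exprS cabsM IH. Qed.

Lemma cabsJ z : cabs (z^*) = cabs z.
Proof. by rewrite /cabs norm_conjC. Qed.

Lemma cabsB z w : cabs z - cabs w <= cabs (z - w).
Proof. by rewrite lerBlDr -{1}(subrK w z) cabsD. Qed.

Lemma cabs_sqr z : toC (cabs z ^+ 2) = z * z^*.
Proof. by rewrite /toC rmorphXn /= -/(toC _) -cabsE normCK. Qed.

Lemma Re_le_cabs z : `|complex.Re z| <= cabs z.
Proof.
by rewrite -lecR -/(toC (cabs z)) -cabsE; exact: normc_ge_Re.
Qed.

Lemma cabs_sum (I : Type) (s : seq I) (P : pred I) (F : I -> R[i]) :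
  cabs (\sum_(i <- s | P i) F i) <= \sum_(i <- s | P i) cabs (F i).
Proof.
elim/big_rec2: _ => [|i x z _ h]; first by rewrite cabs0.
by apply: le_trans (cabsD _ _) _; rewrite lerD2l.
Qed.

End Modulus.

(** * Functionals annihilated by sigma *)

(** A functional on the polynomials of degree less than r, with values [x i] on
X^i, extends uniquely to a functional on all polynomials that vanishes on the
ideal of [s]: precompose it with reduction modulo [s]. The values on X^n
then form the solution of the linear recurrence with characteristic polynomial
[s] and initial values [x]. *)
Section ResidueFunctional.
Variables (F : fieldType) (s : {poly F}) (x : nat -> F).

Definition residue_form (p : {poly F}) : F :=
  \sum_(i < (size s).-1) x i * (p %% s)`_i.

Lemma residue_formP c p q : residue_form (c *: p + q) = c * residue_form p + residue_form q.
Proof.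
rewrite /residue_form mulr_sumr -big_split /=; apply: eq_bigr => i _.
by rewrite modpD modpZl coefD coefZ; ring.
Qed.

Lemma residue_form0 : residue_form 0 = 0.
Proof. by rewrite /residue_form big1 // => i _; rewrite mod0p coef0 mulr0. Qed.

Lemma residue_form_mul p : residue_form (s * p) = 0.
Proof. by rewrite /residue_form big1 // => i _; rewrite modp_mulr coef0 mulr0. Qed.

Lemma residue_formX i : (i < (size s).-1)%N -> residue_form 'X^i = x i.
Proof.
move=> h; rewrite /residue_form modp_small; last first.
  by rewrite size_polyXn; case: (size s) h.
rewrite (bigD1 (Ordinal h)) //= coefXn eqxx mulr1 big1 ?addr0 // => j.
by rewrite -val_eqE coefXn /= => /negbTE ->; rewrite mulr0.
Qed.

Lemma residue_form_sum r (p : {poly F}) n : (size p <= r.+1)%N ->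
  \sum_(i < r.+1) p`_i * residue_form 'X^(n + i) = residue_form ('X^n * p).
Proof.
move=> sp; rewrite {2}(_ : p = \poly_(i < r.+1) p`_i); last first.
  by apply/polyP=> i; rewrite coef_poly ltnS; case: leqP => // h;
     rewrite nth_default // (leq_trans sp).
rewrite poly_def mulr_sumr.
elim: r.+1 => [|m IH]; first by rewrite !big_ord0 residue_form0.
rewrite !big_ord_recr /= IH addrC [in RHS]addrC -scalerAr -exprD.
by rewrite residue_formP.
Qed.

End ResidueFunctional.

Section Stable.
Variable R : realType.

(** The values on X^n decay when all roots lie in the open disc. Peeling off one
root [a], the functional p |-> L ((X - a) p) is annihilated by the product over
the other roots, so L X^(n+1) - a L X^n already decays, and a first-order
recurrence with |a| < 1 preserves geometric decay at a slightly worse rate. *)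
Lemma geometric_decay (s : seq R[i]) (L : {poly R[i]} -> R[i]) :
  (forall c p q, L (c *: p + q) = c * L p + L q) ->
  (forall z, z \in s -> cabs z < 1) ->
  (forall p, L ((\prod_(z <- s) ('X - z%:P)) * p) = 0) ->
  exists K t : R, [/\ 0 <= K, 0 <= t < 1 &
     forall n, cabs (L 'X^n) <= K * t ^+ n].
Proof.
elim: s L => [|a s IH] L linL hs L0.
  exists 0, 0; split=> //; first by rewrite lexx ltr01.
  by move=> n; have := L0 'X^n; rewrite big_nil mul1r => ->; rewrite cabs0 mul0r.
have ha : cabs a < 1 by apply: hs; rewrite inE eqxx.
have a0 := cabs_ge0 a.
have [K [t [K0 /andP[t0 t1] hK]]] : exists K t : R, [/\ 0 <= K, 0 <= t < 1 &
    forall n, cabs (L (('X - a%:P) * 'X^n)) <= K * t ^+ n].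
  apply: (IH (fun p => L (('X - a%:P) * p))) => [c p q|z zs|p].
  - by rewrite mulrDr -scalerAr linL.
  - by apply: hs; rewrite inE zs orbT.
  - by rewrite -[RHS](L0 p) big_cons mulrA.
have hrec n : L 'X^(n.+1) = a * L 'X^n + L (('X - a%:P) * 'X^n).
  by rewrite -linL; congr L; rewrite mulrBl mul_polyC addrC subrK exprS.
(* Any rate below 1 that is at least t and exceeds |a| will do. *)
pose t' := 1 - (1 - t) * (1 - cabs a) / 2.
have ht' : t <= t' by rewrite /t'; nra.
have hat' : cabs a < t' by rewrite /t'; nra.
have t'1 : t' < 1 by rewrite /t'; nra.
pose K' := cabs (L 1) + K / (t' - cabs a).
have K'0 : 0 <= K / (t' - cabs a) by apply: divr_ge0 => //; lra.
have L1 := cabs_ge0 (L 1).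
have hK' : K <= (t' - cabs a) * K'.
  rewrite /K' mulrDr [X in _ + X]mulrC divfK; last by lra.
  by rewrite lerDr mulr_ge0 //; lra.
have K'p : 0 <= K' by rewrite /K' addr_ge0.
exists K', t'; split; [by []|by rewrite t'1 andbT; lra|].
elim=> [|n IHn]; first by rewrite !expr0 mulr1 /K' lerDl.
rewrite hrec; apply: le_trans (cabsD _ _) _; rewrite cabsM exprS.
have h1 := hK n.
have h2 : K * t ^+ n <= K * t' ^+ n by rewrite ler_wpM2l // lerXn2r // nnegrE; lra.
have h3 : cabs a * cabs (L 'X^n) <= cabs a * (K' * t' ^+ n) by rewrite ler_wpM2l.
have tn : 0 <= t' ^+ n by rewrite exprn_ge0 //; lra.
have h4 : K * t' ^+ n <= ((t' - cabs a) * K') * t' ^+ n by rewrite ler_wpM2r.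
by nra.
Qed.

Lemma ge0_geometric (y M t : R) : 0 <= t < 1 ->
  (forall n, - (M * t ^+ n) <= y) -> 0 <= y.
Proof.
move=> /andP[t0 t1] h.
have ct : `|t| < 1 by rewrite ger0_norm.
have hc : ((- geometric M t : R^nat) n @[n --> \oo] --> (0 : R))%classic.
  by rewrite -oppr0; apply: cvgN; exact: cvg_geometric.
by apply: (cvgr_to_le hc); apply: nearW => n; apply: h.
Qed.

Definition quad_form r (g : nat -> nat -> R) (u : nat -> R) : R :=
  \sum_(i < r) \sum_(j < r) g i j * (u i * u j).

(** Let L be the functional extending [x] and [u n] the sequence of its values
on X^n, X^(n+1), ... Since L kills the multiples of [b], the kernel identity
applied to [u n] in both variables loses its terms in [b] and becomes a Lyapunov
inequality for the quadratic form of [g] along the orbit [u 0], [u 1], ... *)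
Section Decrease.
Variables (r : nat) (a b l q : {poly R}) (c : R) (g : nat -> nat -> R).
Hypotheses (sa : (size a <= r.+1)%N) (sb : size b = r.+1)
  (sl : (size l <= r.+1)%N) (sq : (size q <= r.+1)%N).
Hypothesis kerE : forall i j, (i <= r)%N -> (j <= r)%N ->
  residual_kernel (nth 0 a) (nth 0 b) (nth 0 l) c (nth 0 q) i j
    = shift_kernel r g i j.
Variable x : nat -> R.
Let u n i := residue_form b x 'X^(n + i).

Lemma residue_form_b n : residue_form b x ('X^n * b) = 0.
Proof. by rewrite mulrC residue_form_mul. Qed.

Lemma kernel_residue_form n (v : nat -> R) :
  residue_form b x ('X^n * a) * (\sum_(i < r.+1) b`_i * v i)
  - c * residue_form b x ('X^n * l) * (\sum_(i < r.+1) l`_i * v i)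
  - residue_form b x ('X^n * q) * (\sum_(i < r.+1) q`_i * v i)
  = \sum_(i < r) \sum_(j < r) g i j * (u n.+1 i * v j.+1 - u n i * v j).
Proof.
have := @kernel_eval _ _ idfun r _ _ _ _ _ _ kerE (u n) v; rewrite /= /u.
rewrite !residue_form_sum ?sb // residue_form_b mul0r addr0 => ->.
by apply: eq_bigr => i _; apply: eq_bigr => j _; rewrite addnS.
Qed.

Lemma quad_form_decr n :
  quad_form r g (u n.+1) =
  quad_form r g (u n) - c * residue_form b x ('X^n * l) ^+ 2
    - residue_form b x ('X^n * q) ^+ 2.
Proof.
have := kernel_residue_form n (u n); rewrite /u.
rewrite !residue_form_sum ?sb // residue_form_b mulr0 sub0r.
rewrite -/(u n) -/(u n.+1) => e.
have -> : quad_form r g (u n.+1) = quad_form r g (u n) +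
  \sum_(i < r) \sum_(j < r) g i j * (u n.+1 i * u n j.+1 - u n i * u n j).
  rewrite /quad_form -big_split /=; apply: eq_bigr => i _; rewrite -big_split /=.
  by apply: eq_bigr => j _; rewrite /u addnS; ring.
by rewrite /u -e; ring.
Qed.

Lemma quad_form0 : quad_form r g (u 0) = quad_form r g x.
Proof.
apply: eq_bigr => i _; apply: eq_bigr => j _.
by rewrite /u !add0n !residue_formX ?sb.
Qed.

Hypothesis c0 : 0 <= c.

(** When all roots of [b] lie in the open disc, the form is nonincreasing along an orbit that
tends to zero, hence it is nonnegative at the start of the orbit. *)
Lemma psd_of_stable :
  (forall z : R[i], root (polyC_of b) z -> cabs z < 1) -> 0 <= quad_form r g x.
Proof.
move=> hroot.
have [s bE] := closed_field_poly_normal (polyC_of b).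
have b0 : b != 0 by rewrite -size_poly_eq0 sb.
have lb0 : lead_coef (polyC_of b) != 0.
  by rewrite lead_coef_eq0 map_poly_eq0.
pose L := residue_form (polyC_of b) (fun i => toC (x i)).
have LE n : L 'X^n = toC (residue_form b x 'X^n).
  rewrite /L /residue_form size_map_poly /toC rmorph_sum /=; apply: eq_bigr => i _.
  by rewrite rmorphM /= -coef_map /= map_modp map_polyXn.
have [||K [t [K0 t01 hK]]] := @geometric_decay s L (residue_formP _ _).
- by move=> z zs; apply: hroot; rewrite bE rootZ // root_prod_XsubC.
- move=> p; rewrite /L -(scalerK lb0 (\prod_(z <- s) _)) -bE -scalerAl.
  by rewrite -[_ *: _]addr0 residue_formP residue_form_mul residue_form0 mulr0 addr0.
have hu n i : `|u n i| <= K * t ^+ n.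
  rewrite -cabs_toC -LE; apply: le_trans (hK _) _; rewrite ler_wpM2l //.
  by case/andP: t01 => t0 t1; rewrite ler_wiXn2l ?leq_addr // ltW.
have mono n : quad_form r g (u n.+1) <= quad_form r g (u n).
  rewrite quad_form_decr -addrA gerDl -opprD oppr_le0 addr_ge0 ?sqr_ge0 //.
  by rewrite mulr_ge0 // sqr_ge0.
have mono0 n : quad_form r g (u n) <= quad_form r g (u 0).
  by elim: n => // n; apply: le_trans (mono n).
rewrite -quad_form0.
apply: (@ge0_geometric _ (\sum_(i < r) \sum_(j < r) `|g i j| * (K * K)) t) => // n.
apply: le_trans (mono0 n); rewrite lerNl.
apply: le_trans (ler_norm _) _; rewrite normrN.
apply: le_trans (ler_norm_sum _ _ _) _; rewrite mulr_suml ler_sum // => i _.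
apply: le_trans (ler_norm_sum _ _ _) _; rewrite mulr_suml ler_sum // => j _.
rewrite !normrM -mulrA ler_wpM2l //.
apply: le_trans (ler_pM _ _ (hu n i) (hu n j)) _ => //.
case/andP: t01 => t0 t1.
rewrite mulrACA ler_wpM2l ?mulr_ge0 // ler_piMl ?exprn_ge0 //.
by rewrite exprn_ile1 // ltW.
Qed.

End Decrease.
End Stable.

Lemma residue_form_mul0 (F : fieldType) (s : {poly F}) (x : nat -> F) (a : {poly F}) :
  (forall n, residue_form s x ('X^n * a) = 0) ->
  forall p, residue_form s x (p * a) = 0.
Proof.
move=> h p; rewrite -[p]mul1r -(expr0 'X); move: 0%N.
elim/poly_ind: p => [n|p c IH n]; first by rewrite mulr0 mul0r residue_form0.
have -> : 'X^n * (p * 'X + c%:P) * a = c *: ('X^n * a) + 'X^(n.+1) * p * a.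
  by rewrite -mul_polyC exprS; ring.
by rewrite residue_formP h IH mulr0 addr0.
Qed.

Lemma sum_mul_delta (K : pzSemiRingType) r j (F : nat -> K) : (j < r)%N ->
  \sum_(i < r) F i * (i == j :> nat)%:R = F j.
Proof.
move=> jr; rewrite (bigD1 (Ordinal jr)) //= eqxx mulr1 big1 ?addr0 // => i.
by rewrite -val_eqE /= => /negbTE ->; rewrite mulr0.
Qed.

(** The form at x + t e_j equals 2 t B + t^2 g j j with B the j-th coordinate of
g x; it can be nonnegative for all t only if B = 0. *)
Lemma psd_kernel (R : realType) r (g : nat -> nat -> R) (x : nat -> R) :
  (forall i j, g i j = g j i) -> (forall y, 0 <= quad_form r g y) ->
  quad_form r g x = 0 -> forall j, (j < r)%N -> \sum_(i < r) g i j * x i = 0.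
Proof.
move=> gs psd x0 j jr; set B := \sum_(i < r) _.
pose e t i : R := x i + t * (i == j)%:R.
have gjj : \sum_(i < r) \sum_(k < r) g i k * ((i == j :> nat)%:R * (k == j :> nat)%:R)
  = g j j.
  rewrite -[RHS](@sum_mul_delta _ r j (g^~ j)) //; apply: eq_bigr => i _.
  rewrite -[in RHS](@sum_mul_delta _ r j (g i)) // mulr_suml.
  by apply: eq_bigr => k _; rewrite -mulrA [X in _ * X]mulrC.
have gxj : \sum_(i < r) \sum_(k < r) g i k * (x i * (k == j :> nat)%:R) = B.
  apply: eq_bigr => i _; under eq_bigr do rewrite mulrA.
  by rewrite (sum_mul_delta (fun k => g i k * x i)).
have gjx : \sum_(i < r) \sum_(k < r) g i k * ((i == j :> nat)%:R * x k) = B.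
  rewrite -gxj exchange_big; apply: eq_bigr => i _; apply: eq_bigr => k _ /=.
  by rewrite gs [X in _ * X]mulrC.
have expand t : quad_form r g (e t) = 2 * t * B + t ^+ 2 * g j j.
  rewrite -[RHS]add0r -x0 -{1}gjj.
  have -> : 2 * t * B = t * B + t * B by ring.
  rewrite -{1}gxj -gjx !mulr_sumr -!big_split /=; apply: eq_bigr => i _.
  rewrite !mulr_sumr -!big_split /=; apply: eq_bigr => k _.
  by rewrite /e; ring.
have g0 : 0 <= g j j.
  have := psd (fun i => (i == j)%:R); suff -> : quad_form r g (fun i => (i == j)%:R) = g j j by [].
  exact: gjj.
have [//|Bn0] := eqVneq B 0.
(* Minimizing over t would divide by g j j, which may be 0. *)
have := psd (e (- B / (g j j + 1))); rewrite expand => h; exfalso.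
have B2 : 0 < B ^+ 2 by rewrite exprn_even_gt0.
set d := g j j + 1 in h *.
have d0 : 0 < d by rewrite /d; lra.
have e1 : 2 * (- B / d) * B + (- B / d) ^+ 2 * g j j
   = - (B ^+ 2 * (d + 1)) / d ^+ 2.
  have -> : g j j = d - 1 by rewrite /d; ring.
  by field; lra.
move: h; rewrite e1 leNgt => /negP; apply.
rewrite mulNr oppr_lt0 divr_gt0 ?exprn_gt0 // mulr_gt0 //; lra.
Qed.

(** Coprimality upgrades semidefiniteness to definiteness. If the form vanishes
at [x] it vanishes along the whole orbit of [x], being nonincreasing and
nonnegative; so [g] annihilates the orbit, and L(z^n q) = c L(z^n l) = 0 for
all n. The kernel identity with the functional applied in one variable only
reduces to L(z^n a) b(w) = 0, so L kills the ideal of [a] as well as that of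
[b], and a Bezout relation gives L = 0. *)
Lemma pd_of_psd (R : realType) r (a b l q : {poly R}) c (g : nat -> nat -> R) :
  (size a <= r.+1)%N -> size b = r.+1 ->
  (size l <= r.+1)%N -> (size q <= r.+1)%N ->
  (forall i j, (i <= r)%N -> (j <= r)%N ->
    residual_kernel (nth 0 a) (nth 0 b) (nth 0 l) c (nth 0 q) i j
    = shift_kernel r g i j) ->
  0 <= c -> coprimep a b -> (forall i j, g i j = g j i) ->
  (forall y, 0 <= quad_form r g y) ->
  forall x, quad_form r g x = 0 -> forall i, (i < r)%N -> x i = 0.
Proof.
move=> sa sb sl sq kerE c0 cop gs psd x x0 i ir.
have decr := quad_form_decr sa sb sl sq kerE x.
have decr' n : quad_form r g (fun i => residue_form b x 'X^(n.+1 + i)) =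
  quad_form r g (fun i => residue_form b x 'X^(n + i))
    - c * residue_form b x ('X^n * l) ^+ 2 - residue_form b x ('X^n * q) ^+ 2.
  exact: decr.
have all0 n : quad_form r g (fun i => residue_form b x 'X^(n + i)) = 0.
  elim: n => [|n IH]; first by rewrite (quad_form0 g sb).
  apply/eqP; rewrite eq_le psd andbT decr' IH.
  have := sqr_ge0 (residue_form b x ('X^n * q)).
  have := mulr_ge0 c0 (sqr_ge0 (residue_form b x ('X^n * l))); lra.
have Lq n : residue_form b x ('X^n * q) = 0.
  apply/eqP; rewrite -sqrf_eq0; apply/eqP.
  have := decr' n; rewrite !all0.
  have := sqr_ge0 (residue_form b x ('X^n * q)).
  have := mulr_ge0 c0 (sqr_ge0 (residue_form b x ('X^n * l))); lra.
have Ll n : c * residue_form b x ('X^n * l) = 0.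
  have : c * residue_form b x ('X^n * l) ^+ 2 = 0.
    have := decr' n; rewrite !all0 Lq; lra.
  by move=> /eqP; rewrite mulf_eq0 sqrf_eq0 -mulf_eq0 => /eqP.
have br0 : b`_r != 0.
  by rewrite -[r]/(r.+1.-1) -sb -/(lead_coef b) lead_coef_eq0 -size_poly_eq0 sb.
have La n : residue_form b x ('X^n * a) = 0.
  have := kernel_residue_form sa sb sl sq kerE x n (fun i => (i == r)%:R).
  rewrite Lq Ll !mul0r !subr0.
  have -> : \sum_(i < r.+1) b`_i * ((i == r :> nat)%:R : R) = b`_r.
    exact: sum_mul_delta.
  move=> e.
  have : residue_form b x ('X^n * a) * b`_r = 0.
    rewrite e; transitivity (\sum_(j < r) (
       (\sum_(i < r) g i j * residue_form b x 'X^(n.+1 + i)) * (j.+1 == r)%:R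
      - (\sum_(i < r) g i j * residue_form b x 'X^(n + i)) * (j == r :> nat)%:R)).
      rewrite exchange_big /=; apply: eq_bigr => j _; rewrite !mulr_suml -sumrB.
      by apply: eq_bigr => k _; ring.
    rewrite big1 // => j _.
    by rewrite (psd_kernel gs psd (all0 n)) // (psd_kernel gs psd (all0 n.+1)) // !mul0r subr0.
  by move=> /eqP; rewrite mulf_eq0 (negbTE br0) orbF => /eqP.
have /Bezout_eq1_coprimepP [[p1 p2] /= bez] := cop.
rewrite -(@residue_formX _ b x i) ?sb // -[X in residue_form b x X]mulr1 -bez mulrDr mulrA.
rewrite -[_ * a]scale1r residue_formP (residue_form_mul0 La) mulr0 add0r.
by rewrite mulrA mulrC residue_form_mul.
Qed.

(** * The Fejer-Riesz factorization *)
Section EvalC.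
Variable R : realType.
Implicit Types (p q : {poly R}) (z : R[i]).

Lemma toCJ (x : R) : (toC x)^* = toC x.
Proof. exact: conjc_real. Qed.

Lemma evalCJ p z : evalC p z^* = (evalC p z)^*.
Proof.
rewrite /evalC -horner_map /= /polyC_of -map_poly_comp /=; congr (_.[_]).
by apply: eq_map_poly => x /=; rewrite -[LHS]/(toC x) -[in LHS]toCJ.
Qed.

Lemma evalCM p q z : evalC (p * q) z = evalC p z * evalC q z.
Proof. by rewrite /evalC /polyC_of rmorphM hornerM. Qed.
Lemma evalCD p q z : evalC (p + q) z = evalC p z + evalC q z.
Proof. by rewrite /evalC /polyC_of rmorphD hornerD. Qed.
Lemma evalCZ (c : R) p z : evalC (c *: p) z = toC c * evalC p z.
Proof. by rewrite /evalC /polyC_of map_polyZ hornerZ. Qed.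

Lemma evalC_sum r p z : (size p <= r)%N ->
  evalC p z = \sum_(i < r) toC p`_i * z ^+ i.
Proof.
move=> sp; rewrite /evalC (@horner_coef_wide _ r) ?size_map_poly //.
by apply: eq_bigr => i _; rewrite coef_map.
Qed.


End EvalC.

Section Recip.
Variable K : fieldType.
Implicit Types p q : {poly K}.

(** The reciprocal polynomial z^n p(1/z). On the unit circle it takes the value
z^n times the conjugate of p(z), so that real trigonometric polynomials turn
into self-reciprocal polynomials. *)
Definition recip n p : {poly K} := \poly_(i < n.+1) p`_(n - i).

Lemma coef_recip n p i : (recip n p)`_i = if (i <= n)%N then p`_(n - i) else 0.
Proof. by rewrite coef_poly ltnS. Qed.

Lemma size_recip n p : (size (recip n p) <= n.+1)%N.
Proof. exact: size_poly. Qed.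

Lemma recipK n p : (size p <= n.+1)%N -> recip n (recip n p) = p.
Proof.
move=> sp; apply/polyP => i; rewrite !coef_recip leq_subr.
case: leqP => [h|h]; first by rewrite subKn.
by rewrite nth_default // (leq_trans sp).
Qed.

Lemma recip_Xn n k : (k <= n)%N -> recip n 'X^k = 'X^(n - k).
Proof.
move=> kn; apply/polyP => i; rewrite coef_recip !coefXn.
case: leqP => h; last by case: eqP => // e; lia.
by congr (nat_of_bool _)%:R; apply/eqP/eqP; lia.
Qed.

Lemma recipP n c p q : recip n (c *: p + q) = c *: recip n p + recip n q.
Proof.
apply/polyP => i; rewrite coefD coefZ !coef_recip.
by case: ifP => _; rewrite ?coefD ?coefZ // mulr0 addr0.
Qed.

Lemma recip0 n : recip n 0 = 0.
Proof. by apply/polyP => i; rewrite coef_recip !coef0 if_same. Qed.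

Lemma recip_sum n (I : Type) (s : seq I) (c : I -> K) (F : I -> {poly K}) :
  recip n (\sum_(i <- s) c i *: F i) = \sum_(i <- s) c i *: recip n (F i).
Proof.
elim: s => [|i s IH]; first by rewrite !big_nil recip0.
by rewrite !big_cons recipP IH.
Qed.

Lemma recipM m n p q : (size p <= m.+1)%N -> (size q <= n.+1)%N ->
  recip (m + n) (p * q) = recip m p * recip n q.
Proof.
have coefW k (f : {poly K}) : (size f <= k.+1)%N -> f = \sum_(i < k.+1) f`_i *: 'X^i.
  move=> sf; rewrite -poly_def; apply/polyP => i.
  by rewrite coef_poly ltnS; case: leqP => // h; rewrite nth_default // (leq_trans sf).
have recW k (f : {poly K}) : (size f <= k.+1)%N ->
    recip k f = \sum_(i < k.+1) f`_i *: 'X^(k - i).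
  move=> sf; rewrite {1}(coefW k f sf) recip_sum; apply: eq_bigr => i _.
  by rewrite recip_Xn // -ltnS.
move=> sp sq; rewrite (recW m p) // {1}(coefW m p sp) !big_distrl /=.
under eq_bigr do rewrite -scalerAl; rewrite recip_sum.
apply: eq_bigr => i _; rewrite -scalerAl; congr (_ *: _).
rewrite (recW n q) // {1}(coefW n q sq) !big_distrr /=.
under eq_bigr do rewrite -scalerAr -exprD; rewrite recip_sum.
have im : (i <= m)%N by rewrite -ltnS.
apply: eq_bigr => j _; have jn : (j <= n)%N by rewrite -ltnS.
rewrite recip_Xn ?leq_add // -scalerAr -exprD; congr (_ *: 'X^_); lia.
Qed.

Lemma horner_recip n p (x : K) : (size p <= n.+1)%N -> x != 0 ->
  (recip n p).[x] = x ^+ n * p.[x^-1].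
Proof.
move=> sp x0; rewrite (@horner_coef_wide _ n.+1 p) //.
rewrite (@horner_coef_wide _ n.+1) ?size_recip // (reindex_inj rev_ord_inj) /=.
rewrite mulr_sumr; apply: eq_bigr => i _; rewrite coef_recip subSS.
have iln : (i <= n)%N by rewrite -ltnS.
rewrite leq_subr subKn // exprVn mulrCA; congr (_ * _).
have -> : x ^+ n = x ^+ (n - i) * x ^+ i by rewrite -exprD subnK.
by rewrite mulfK // expf_neq0.
Qed.

End Recip.

Section RecipC.
Variable R : realType.
Implicit Types (p q F : {poly R}) (z : R[i]).

Lemma polyC_recip n p : polyC_of (recip n p) = recip n (polyC_of p).
Proof.
apply/polyP => i; rewrite /polyC_of coef_map /= !coef_recip.
by case: ifP => _; rewrite ?coef_map // rmorph0.
Qed.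

Lemma normC1_inv z : `|z| = 1 -> z^-1 = z^*.
Proof. by move=> z1; rewrite invC_norm z1 expr1n invr1 mul1r. Qed.

Lemma evalC_recip n p z : (size p <= n.+1)%N -> `|z| = 1 ->
  evalC (recip n p) z = z ^+ n * (evalC p z)^*.
Proof.
move=> sp z1; have z0 : z != 0 by rewrite -normr_eq0 z1 oner_eq0.
rewrite /evalC polyC_recip horner_recip ?size_map_poly // normC1_inv //.
by rewrite -[_.[_] in LHS]/(evalC p z^*) evalCJ.
Qed.

(** The minimal polynomial of [a] over the reals: X - a, or the quadratic with
roots [a] and its conjugate. Only the common modulus of its roots matters
later. *)
Lemma real_factor_of_root F (a : R[i]) : F != 0 -> root (polyC_of F) a ->
  exists2 D, D %| F & (1 < size D)%N /\
    forall b, root (polyC_of D) b -> `|b| = `|a|.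
Proof.
move=> F0 Fa; have [aR|aNR] := boolP (a \is Num.real).
  have /complex_realP[t at_] := aR; exists ('X - t%:P).
    rewrite dvdp_XsubCl; move: Fa; rewrite at_ /polyC_of /root horner_map.
    by rewrite fmorph_eq0.
  rewrite size_XsubC; split=> // b; rewrite /polyC_of rmorphB /= map_polyX map_polyC.
  by rewrite root_XsubC => /eqP ->; rewrite at_.
pose D : {poly R} := 'X^2 - (2 * complex.Re a) *: 'X + (cabs a ^+ 2)%:P.
have DE : polyC_of D = ('X - a%:P) * ('X - (a^*)%:P).
  rewrite /polyC_of /D rmorphD rmorphB /= map_polyXn map_polyZ map_polyX map_polyC /=.
  rewrite -/(toC (cabs a ^+ 2)) cabs_sqr polyCM.
  have -> : real_complex R (2 * complex.Re a) = a + a^* by rewrite addcJ rmorphM rmorph_nat.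
  by rewrite -mul_polyC polyCD; ring.
have sD : size D = 3.
  rewrite -(size_map_poly (real_complex R)) -/(polyC_of D) DE.
  by rewrite size_mul ?polyXsubC_eq0 // !size_XsubC.
exists D; last first.
  split=> [|b]; first by rewrite sD.
  by rewrite DE rootM !root_XsubC => /orP[] /eqP ->; rewrite // norm_conjC.
rewrite -(dvdp_map (real_complex R)) -/(polyC_of D) DE Gauss_dvdp; last first.
  by rewrite coprimep_XsubC root_XsubC -CrealE.
rewrite !dvdp_XsubCl Fa /=.
by rewrite /root -[_.[_]]/(evalC F a^*) evalCJ conjC_eq0.
Qed.

(** The roots of the reciprocal polynomial are the inverses of the roots of [D],
so their modulus is 1/|a|, which differs from |a|. *)
Lemma recip_coprime (D : {poly R}) (a : R[i]) n : size D = n.+1 ->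
  D`_0 != 0 -> `|a| != 1 ->
  (forall b, root (polyC_of D) b -> `|b| = `|a|) -> coprimep D (recip n D).
Proof.
move=> sD D0 a1 hD.
rewrite -(coprimep_map (real_complex R)); apply/Pdiv.ClosedField.coprimepP => b Db.
have b0 : b != 0.
  apply: contraNneq D0 => b0; move: Db; rewrite b0 /root horner_coef0 coef_map /=.
  by rewrite fmorph_eq0.
rewrite -/(polyC_of _) polyC_recip horner_recip ?size_map_poly ?sD //.
rewrite mulf_neq0 ?expf_neq0 //; apply/negP => Dib.
have e : `|b|^-1 = `|b| by rewrite -normfV (hD _ Dib) hD.
move/negP: a1; apply; rewrite -(hD b Db) -sqrp_eq1 // expr2 -{1}e mulVf //.
by rewrite normr_eq0.
Qed.

(** A strictly positive trigonometric polynomial is q(z) q(1/z) with q real. By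
induction on r: a root [a] of F is not on the circle, and its real minimal
polynomial D and the reciprocal of D are coprime divisors of F. Their product is
|D|^2 up to a power of z on the circle, so dividing it out preserves all the
hypotheses. When F(0) = 0 the degree drops at both ends, and X is divided
out instead. *)
Lemma fejer_riesz r F : (size F <= (r + r).+1)%N -> recip (r + r) F = F ->
  (forall z, `|z| = 1 -> 0 < evalC F z * z^* ^+ r) ->
  exists2 q : {poly R}, (size q <= r.+1)%N & F = q * recip r q.
Proof.
elim/ltn_ind: r F => r IH F sF rF posF.
have F0 : F != 0.
  apply/eqP => F0; have := posF 1 (normr1 _).
  by rewrite F0 /evalC /polyC_of rmorph0 horner0 mul0r ltxx.
have [r0|rpos] := posnP r.
  move: sF posF; rewrite r0 addn0 => sF posF.
  have FE := size1_polyC sF; have := posF 1 (normr1 _).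
  rewrite FE /evalC /polyC_of map_polyC hornerC expr0 mulr1 /= => c0'.
  have c0 : 0 < F`_0 by rewrite -ltcR.
  exists (Num.sqrt F`_0)%:P; first by rewrite size_polyC leq_b1.
  have -> : recip 0 (Num.sqrt F`_0)%:P = (Num.sqrt F`_0)%:P.
    by rewrite -alg_polyC -[_%:A]addr0 recipP recip0 -(expr0 'X) recip_Xn.
  by rewrite -polyCM -expr2 sqr_sqrtr ?ltW.
have [F00|F00] := eqVneq F`_0 0.
  have /factor_theorem [F1 FE] : root F 0 by rewrite /root horner_coef0 F00.
  move: FE; rewrite subr0 => FE.
  have F10 : F1 != 0 by apply: contraNneq F0 => h; rewrite FE h mul0r.
  have Ftop : F`_(r + r) = 0.
    by rewrite -rF coef_recip leqnn subnn.
  have sF' : (size F <= r + r)%N.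
    move: sF; rewrite leq_eqVlt => /orP[/eqP s|//]; exfalso.
    by move: F0; rewrite -lead_coef_eq0 /lead_coef s /= Ftop eqxx.
  move: sF'; rewrite FE size_mulX // => sF1.
  case: r rpos IH sF rF posF Ftop sF1 => // r _ IH sF rF posF Ftop sF1.
  have sF1' : (size F1 <= (r + r).+1)%N by move: sF1; rewrite addnS ltnS.
  have X1 : recip 2 ('X : {poly R}) = 'X by rewrite -['X]expr1 recip_Xn.
  have rF1 : recip (r + r) F1 = F1.
    apply: (mulIf (negbT (polyX_eq0 R))); rewrite -FE -rF FE.
    have -> : (r.+1 + r.+1 = (r + r) + 2)%N by clear; lia.
    by rewrite recipM ?size_polyX // X1.
  have [|q sq qE] := IH r (ltnSn _) F1 sF1' rF1.
    move=> z z1; have := posF z z1.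
    rewrite FE evalCM {2}/evalC [polyC_of 'X]map_polyX hornerX exprS.
    have -> : evalC F1 z * z * (z^* * z^* ^+ r) = evalC F1 z * z^* ^+ r * (z * z^*).
      by ring.
    by rewrite -normCK z1 expr1n mulr1.
  exists q; first by apply: leq_trans sq _.
  rewrite qE -mulrA; congr (q * _).
  rewrite -[q in RHS]mulr1 -addn1 recipM ?size_poly1 //.
  by rewrite -(expr0 'X) recip_Xn.
have Ftop : F`_(r + r) != 0.
  by rewrite -rF coef_recip leqnn subnn.
have [a Fa] : exists a : R[i], root (polyC_of F) a.
  apply/closed_rootP; rewrite size_map_poly; apply: contraNneq Ftop => s1.
  rewrite nth_default // s1; clear - rpos; lia.
have a1 : `|a| != 1.
  apply/eqP => a1; have := posF a a1; move/rootP: Fa.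
  by rewrite -/(evalC F a) => ->; rewrite mul0r ltxx.
have [D DF [sD hD]] := real_factor_of_root F0 Fa.
have [d sDd] : exists d, size D = d.+1 by exists (size D).-1; rewrite prednK // ltnW.
have D00 : D`_0 != 0.
  apply: contraNneq F00; case/dvdpP: DF => E -> D00.
  by rewrite coefM big_ord1 D00 mulr0.
have cop := recip_coprime sDd D00 a1 hD.
have sdr : (d <= r + r)%N by rewrite -ltnS -sDd (leq_trans (dvdp_leq F0 DF)).

have rDF : recip d D %| F.
  case/dvdpP: (DF) => E FE.
  have E0 : E != 0 by apply: contraNneq F0 => h; rewrite FE h mul0r.
  have D0 : D != 0 by apply: contraNneq D00 => ->; rewrite coef0.
  have sE : (size E <= (r + r - d).+1)%N.
    move: sF; rewrite FE size_mul // sDd.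
    by move: (size E) => e; clear - sdr; lia.
  have e : (r + r = (r + r - d) + d)%N by clear - sdr; lia.
  by rewrite -rF FE e recipM ?sDd // dvdp_mull.
have /dvdpP [F1 FE] : D * recip d D %| F by rewrite Gauss_dvdp // DF rDF.
have D0 : D != 0 by apply: contraNneq D00 => ->; rewrite coef0.
have rD0 : recip d D != 0.
  apply/eqP => /(congr1 (recip d)); rewrite recipK ?sDd // recip0 => /eqP.
  by rewrite (negbTE D0).
(* F1 has degree at most 2 (r - d) and inherits the hypotheses. *)
have DD0 : D * recip d D != 0 by rewrite mulf_neq0.
have srD : size (recip d D) = d.+1.
  apply/eqP; rewrite eqn_leq size_recip /= ltnNge; apply/negP => h.
  have : (recip d D)`_d = 0 by rewrite nth_default.
  by rewrite coef_recip leqnn subnn => /eqP; rewrite (negbTE D00).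
have F10 : F1 != 0 by apply: contraNneq F0 => h; rewrite FE h mul0r.
have sF1 : (size F1 + (d + d) <= (r + r).+1)%N.
  move: sF; rewrite FE size_mul // size_mul // srD sDd.
  by move: (size F1) => e; clear; lia.
have sF1p : (0 < size F1)%N by rewrite size_poly_gt0.
have dr : (d <= r)%N by move: (size F1) sF1 sF1p => e; clear; lia.
have sF1' : (size F1 <= ((r - d) + (r - d)).+1)%N by move: (size F1) sF1 => e; clear - dr; lia.
have rDD : recip (d + d) (D * recip d D) = D * recip d D.
  by rewrite recipM ?sDd ?srD // recipK ?sDd // mulrC.
have rF1 : recip ((r - d) + (r - d)) F1 = F1.
  apply: (mulIf DD0); rewrite -FE -rF FE.
  have -> : (r + r = ((r - d) + (r - d)) + (d + d))%N by clear - dr; lia.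
  rewrite recipM ?rDD // size_mul // sDd srD.
  by clear; lia.
have rdr : (r - d < r)%N.
  by move: sD; rewrite sDd; clear - rpos; lia.
have [|q sq qE] := IH (r - d)%N rdr F1 sF1' rF1.
  move=> z z1; have := posF z z1; rewrite FE evalCM evalCM evalC_recip ?sDd //.
  have Dz : evalC D z != 0.
    apply/eqP => Dz; have := posF z z1.
    by rewrite FE !evalCM Dz !(mulr0, mul0r) ltxx.
  have -> : z^* ^+ r = z^* ^+ (r - d) * z^* ^+ d by rewrite -exprD subnK.
  have -> : evalC F1 z * (evalC D z * (z ^+ d * (evalC D z)^*)) *
     (z^* ^+ (r - d) * z^* ^+ d) =
     (evalC D z * (evalC D z)^*) * (z * z^*) ^+ d * (evalC F1 z * z^* ^+ (r - d)).
    by rewrite exprMn; ring.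
  rewrite -!normCK z1 expr1n expr1n mulr1 pmulr_rgt0 // exprn_gt0 // normr_gt0 //.
exists (D * q).
  apply: leq_trans (size_mul_leq _ _) _; rewrite sDd.
  by move: (size q) sq => e; clear - dr; lia.
have -> : r = (d + (r - d))%N by clear - dr; lia.
by rewrite recipM ?sDd // FE qE; ring.
Qed.

End RecipC.

(** * Spectral factors: the strict case and passage to the limit *)
Section Spectral.
Variable R : realType.

(** The residual kernel [h] is divisible by z w - 1, and the quotient is positive
semidefinite. Both conditions are closed under pointwise limits of [h]. *)
Definition spectral r (h : nat -> nat -> R) : Prop :=
  (forall j, (j <= r)%N -> diagsum h r j = 0) /\
  (forall x, 0 <= quad_form r (diagsum h) x).

(** Fejer-Riesz gives q, the stability of [b] gives semidefiniteness. *)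
Lemma strict_spectral r (a b l : {poly R}) (c : R) :
  (size a <= r.+1)%N -> size b = r.+1 -> (size l <= r.+1)%N -> 0 <= c ->
  (forall z : R[i], `|z| = 1 ->
     0 < evalC a z * (evalC b z)^* + evalC b z * (evalC a z)^*
         - toC c * (evalC l z * (evalC l z)^*)) ->
  (forall z : R[i], root (polyC_of b) z -> cabs z < 1) ->
  exists2 q : {poly R}, (size q <= r.+1)%N &
    spectral r (residual_kernel (nth 0 a) (nth 0 b) (nth 0 l) c (nth 0 q)).
Proof.
move=> sa sb sl c0 pos stab.
have sb' : (size b <= r.+1)%N by rewrite sb.
pose F := (- c) *: (l * recip r l) + (a * recip r b + b * recip r a).
have sM (p p' : {poly R}) : (size p <= r.+1)%N ->
    (size (p * recip r p')%R <= (r + r).+1)%N.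
  move=> sp; apply: leq_trans (size_polyMleq _ _) _.
  rewrite -subn1 leq_subLR add1n -addnS -addSn.
  by rewrite leq_add // size_recip.
have sF : (size F <= (r + r).+1)%N.
  rewrite (leq_trans (size_polyD _ _)) // geq_max (leq_trans (size_scale_leq _ _)) ?sM //=.
  by rewrite (leq_trans (size_polyD _ _)) // geq_max !sM.
have rF : recip (r + r) F = F.
  rewrite /F recipP -[_ + b * _]scale1r scalerDr -[1 *: (b * _)]addr0.
  rewrite recipP recipP recip0 !addr0 !scale1r.
  rewrite !recipM ?size_recip // !recipK // (mulrC (recip r l)).
  by rewrite [recip r a * _]mulrC [recip r b * _]mulrC [X in _ + X]addrC.
have posF z : `|z| = 1 -> 0 < evalC F z * z^* ^+ r.
  move=> z1; have := pos z z1; congr (0 < _).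
  rewrite /F evalCD evalCZ evalCD !evalCM !evalC_recip // /toC rmorphN /=.
  rewrite -/(toC c).
  have e : z ^+ r * z^* ^+ r = 1 by rewrite -exprMn -normCK z1 !expr1n.
  transitivity ((- toC c * (evalC l z * (evalC l z)^*) +
    (evalC a z * (evalC b z)^* + evalC b z * (evalC a z)^*)) * (z ^+ r * z^* ^+ r)).
    by rewrite e; ring.
  by ring.
have [q sq qE] := fejer_riesz sF rF posF.
exists q => //; set h := residual_kernel _ _ _ _ _.
have D0 j : (j <= r)%N -> diagsum h r j = 0.
  move=> jr; rewrite /diagsum (minn_idPr jr).
  have -> : \sum_(k < j.+1) h (r - k)%N (j - k)%N =
    (recip r a * b + recip r b * a - c *: (recip r l * l) - recip r q * q)`_j.
    rewrite !coefB coefD coefZ !coefM mulr_sumr -big_split -!sumrB /=.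
    apply: eq_bigr => k _; rewrite !coef_recip.
    have -> : (k <= r)%N by apply: leq_trans jr; rewrite -ltnS.
    by rewrite /h /residual_kernel mulrA.
  rewrite [recip r q * q]mulrC -qE /F.
  rewrite (_ : _ - _ = 0) ?coef0 ?oppr0 // -!mul_polyC polyCN; ring.
split=> // x.
apply: (@psd_of_stable R r a b l q c) => //.
by apply: diagsum_shift_kernel => // i j; rewrite /h residual_kernel_sym.
Qed.

Lemma common_subsequence m (f : nat -> nat -> R) :
  (forall i, (i < m)%N -> bounded_fun (f i)) ->
  exists2 phi : nat -> nat, increasing_seq phi &
    forall i, (i < m)%N -> cvgn (f i \o phi).
Proof.
elim: m => [|m IH] hf; first by exists id.
have [i im|phi incr hphi] := IH; first by apply: hf; rewrite ltnW.
have : bounded_fun (f m \o phi).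
  have [M [Mr hM]] := hf m (ltnSn m); exists M; split=> // x /hM h y _.
  exact: h.
move=> /bolzano_weierstrass [psi incr' hpsi].
exists (phi \o psi); first by move=> i j; rewrite -(incr' i j); exact: incr.
move=> i; rewrite ltnS leq_eqVlt => /orP[/eqP ->|im]; first exact: hpsi.
have /cvg_ex[L hL] := hphi i im; apply/cvg_ex; exists L.
apply: cvg_comp hL; apply/cvgnyPge => A; exists A => // n /= An.
exact: leq_trans An (unstable.mono_leq_infl incr' n).
Qed.

Lemma cvg_sumr (I : Type) (s : seq I) (f : I -> nat -> R) (L : I -> R) :
  (forall i, f i n @[n --> \oo] --> L i)%classic ->
  ((\sum_(i <- s) f i n) @[n --> \oo] --> \sum_(i <- s) L i)%classic.
Proof.
move=> h; elim: s => [|i s IH].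
  by rewrite big_nil; under eq_fun do rewrite big_nil; apply: cvg_cst.
by rewrite big_cons; under eq_fun do rewrite big_cons; apply: cvgD.
Qed.

(** Compactness of the set of spectral factors: vanishing of the (r, r) diagonal
sum says that the squares of the coefficients of [qn n] sum up to the trace of
[M n], which converges, so a subsequence of [qn] converges coefficientwise. *)
Lemma spectral_limit r (M : nat -> nat -> nat -> R) (M0 : nat -> nat -> R)
    (qn : nat -> {poly R}) :
  (forall i j, M n i j @[n --> \oo] --> M0 i j)%classic ->
  (forall n, (size (qn n) <= r.+1)%N) ->
  (forall n, spectral r (fun i j => M n i j - (qn n)`_i * (qn n)`_j)) ->
  exists2 q : {poly R}, (size q <= r.+1)%N &
    spectral r (fun i j => M0 i j - q`_i * q`_j).
Proof.
move=> hM sq hs.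
pose T n := \sum_(k < r.+1) M n (r - k)%N (r - k)%N.
have cT : cvgn T by apply/cvg_ex; eexists; apply: cvg_sumr => k; apply: hM.
have TE n : T n = \sum_(k < r.+1) (qn n)`_(r - k) ^+ 2.
  have [/(_ r (leqnn r)) + _] := hs n; rewrite /diagsum minnn => /eqP.
  by rewrite oppr_eq0 sumrB subr_eq0 => /eqP.
have qT n i : (i < r.+1)%N -> `|(qn n)`_i| <= 1 + T n.
  (* |x| <= 1 + x^2 spares a square root in the bound. *)
  move=> ir; have : (qn n)`_i ^+ 2 <= T n.
    have sir : (r - i < r.+1)%N by rewrite ltnS leq_subr.
    rewrite TE (bigD1 (Ordinal sir)) //= subKn // lerDl sumr_ge0 // => k _.
    exact: sqr_ge0.
  rewrite -(real_normK (num_real _)); move: `|_| => y; nra.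
have bq i : (i < r.+1)%N -> bounded_fun (fun n => (qn n)`_i).
  move=> ir; have [K [Kr hK]] := cvg_seq_bounded cT.
  exists (1 + K); split; first by rewrite num_real.
  move=> y hy n _; apply: le_trans (qT n i ir) _.
  have := hK (y - 1) _ n I; rewrite ltrBrDl => /(_ hy).
  by move=> /(le_trans (ler_norm _)); rewrite lerBrDl.
have [phi incr hphi] := common_subsequence bq.
have cphi : (phi n @[n --> \oo] --> \oo)%classic.
  apply/cvgnyPge => A; exists A => // n /= An.
  exact: leq_trans An (unstable.mono_leq_infl incr n).
pose q := \poly_(i < r.+1) lim ((qn (phi n))`_i @[n --> \oo])%classic.
have cq i : ((qn (phi n))`_i @[n --> \oo] --> q`_i)%classic.
  rewrite coef_poly; case: ifPn => ir; first exact: hphi.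
  under eq_fun do rewrite nth_default ?(leq_trans (sq _)) 1?leqNgt //.
  exact: cvg_cst.
exists q; first exact: size_poly.
pose h n i j := M (phi n) i j - (qn (phi n))`_i * (qn (phi n))`_j.
have ch i j : (h n i j @[n --> \oo] --> M0 i j - q`_i * q`_j)%classic.
  apply: cvgB; last by apply: cvgM.
  exact: (@cvg_comp _ _ _ phi (fun n => M n i j) _ _ _ cphi (hM i j)).
have cg i j : (diagsum (h n) i j @[n --> \oo] -->
    diagsum (fun i j => (M0 i j - q`_i * q`_j)) i j)%classic.
  by apply: cvgN; apply: cvg_sumr => k; apply: ch.
split=> [j jr|x].
  have h0 n : diagsum (h n) r j = 0 by have [+ _] := hs (phi n); apply.
  apply/eqP; rewrite eq_le; apply/andP; split.
    by apply: (cvgr_to_le (cg r j)); apply: nearW => n; rewrite h0.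
  by apply: (cvgr_to_ge (cg r j)); apply: nearW => n; rewrite h0.
have cQ : (quad_form r (diagsum (h n)) x @[n --> \oo] -->
    quad_form r (diagsum (fun i j => (M0 i j - q`_i * q`_j))) x)%classic.
  apply: cvg_sumr => i; apply: cvg_sumr => j; apply: cvgM; [exact: cg|exact: cvg_cst].
by apply: (cvgr_to_ge cQ); apply: nearW => n; have [_] := hs (phi n); apply.
Qed.

End Spectral.

(** * Moving the boundary roots of sigma into the open disc *)
Section Perturbation.
Variable R : realType.
Implicit Types (p : {poly R[i]}) (z w : R[i]).

Lemma horner_bound p r z (A : R) : (size p <= r.+1)%N -> 1 <= A -> cabs z <= A ->
  cabs p.[z] <= (\sum_(i < r.+1) cabs p`_i) * A ^+ r.
Proof.
move=> sp A1 zA; rewrite (horner_coef_wide z sp).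
apply: le_trans (cabs_sum _ _ _) _; rewrite mulr_suml ler_sum // => i _.
rewrite cabsM cabsX ler_wpM2l ?cabs_ge0 //.
apply: (@le_trans _ _ (A ^+ i)).
  by rewrite lerXn2r // nnegrE ?cabs_ge0 // (le_trans _ A1).
by rewrite ler_weXn2l // -ltnS.
Qed.

(** p(z) - p(w) is divisible by z - w, and the quotient is bounded near w. *)
Lemma horner_continuous p w (e : R) : 0 < e ->
  exists2 d : R, 0 < d & forall z, cabs (z - w) < d -> cabs (p.[z] - p.[w]) < e.
Proof.
move=> e0; have /factor_theorem [q qE] : root (p - (p.[w])%:P) w.
  by rewrite /root hornerD hornerN hornerC subrr.
pose A := 1 + cabs w.
pose B := (\sum_(i < (size q).+1) cabs q`_i) * A ^+ size q.
have A1 : 1 <= A by rewrite /A lerDl cabs_ge0.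
have B0 : 0 <= B.
  rewrite /B mulr_ge0 ?exprn_ge0 //; last by lra.
  by rewrite sumr_ge0 // => i _; rewrite cabs_ge0.
have d0 : 0 < e + B + 1 by lra.
exists (e / (e + B + 1)) => [|z]; first by rewrite divr_gt0.
rewrite ltr_pdivlMr // => hz; have zw0 := cabs_ge0 (z - w).
have zA : cabs z <= A.
  have : cabs z <= cabs (z - w) + cabs w by rewrite -{1}(subrK w z) cabsD.
  rewrite /A; suff : cabs (z - w) <= 1 by lra.
  by rewrite leNgt; apply/negP => h; nra.
have := horner_bound (leqnSn (size q)) A1 zA; rewrite -/B => qB.
have -> : p.[z] - p.[w] = q.[z] * (z - w).
  by have := congr1 (horner^~ z) qE; rewrite !hornerE.
rewrite cabsM; have := cabs_ge0 q.[z]; nra.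
Qed.

Variables (r : nat) (a b : {poly R}).
Hypotheses (sa : (size a <= r.+1)%N) (sb : size b = r.+1).

(** To first order the root of b + e a near [w] is w - e a(w)/b'(w), that is,
w (1 - e c) where c = a(w)/b'(w) times the conjugate of w is positive by
hypothesis: it moves inwards. Quantitatively, write b = (X - w) t; a root z of
b + e a satisfies conj(w) z t(z) = t(z) (1 - e c) - e P(z) with
P = conj(w) a - c t. As P vanishes at w and t does not, |P(z)| < c |t(z)| / 2
near w, and this forces |z| < 1. *)
Lemma local_boundary_root w : `|w| = 1 -> root (polyC_of b) w ->
  0 < evalC a w / evalC b^`() w * w^* ->
  exists d e1 : R, [/\ 0 < d, 0 < e1 & forall (e : R) z, 0 < e < e1 ->
    cabs (z - w) < d -> 1 <= cabs z -> evalC b z + toC e * evalC a z != 0].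
Proof.
move=> w1 rw c0; have /factor_theorem [t tE] := rw.
have tw : evalC b^`() w = t.[w].
  rewrite /evalC /polyC_of -deriv_map -/(polyC_of b) tE derivM derivXsubC mulr1.
  by rewrite hornerD hornerM hornerXsubC subrr mulr0 add0r.
have tw0 : t.[w] != 0.
  by apply: contraTneq c0 => e; rewrite tw e invr0 mulr0 mul0r ltxx.
have [c cE] : exists c : R, evalC a w / evalC b^`() w * w^* = toC c.
  by apply/complex_realP; apply: gtr0_real.
have cp : 0 < c by rewrite -ltcR -/(toC c) -cE.
pose P := w^* *: polyC_of a - toC c *: t.
have Pw : P.[w] = 0.
  rewrite /P hornerD hornerN !hornerZ -cE tw -/(evalC a w); field.
  exact: tw0.
have tw_gt0 : 0 < cabs t.[w] by rewrite cabs_gt0.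
have [d1 d1p hd1] := horner_continuous t w (divr_gt0 tw_gt0 (ltr0n R 2)).
have ep : 0 < c * cabs t.[w] / 4 by rewrite divr_gt0 // mulr_gt0.
have [d2 d2p hd2] := horner_continuous P w ep.
exists (Num.min d1 d2), c^-1; split; rewrite ?lt_min ?d1p ?invr_gt0 // => e z.
move=> /andP[e0 ec]; rewrite lt_min => /andP[/hd1 ht /hd2 hP] z1.
move: ec; rewrite -(ltr_pM2r cp) mulVf ?(gt_eqF cp) // => ec.
rewrite Pw subr0 in hP.
have tz : cabs t.[w] / 2 < cabs t.[z].
  have := cabsB t.[w] (t.[w] - t.[z]).
  rewrite subKr -[cabs (_ - t.[z])]cabsN opprB; lra.
apply/eqP => E; rewrite /evalC -/(polyC_of b) tE hornerM hornerXsubC -/(evalC a z) in E.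
have zt : w^* * z * t.[z] = t.[z] * toC (1 - e * c) - toC e * P.[z].
  have ww : w^* * w = 1 by rewrite mulrC -normCK w1 expr1n.
  rewrite /P hornerD hornerN !hornerZ -/(evalC a z).
  have -> : toC (1 - e * c) = 1 - toC e * toC c by rewrite /toC rmorphB rmorphM rmorph1.
  have Ea : toC e * evalC a z = - (t.[z] * (z - w)) by apply/eqP; rewrite -addr_eq0 addrC E.
  transitivity (t.[z] * (w^* * w) + w^* * (t.[z] * (z - w))); first by ring.
  rewrite ww; have -> : t.[z] * (z - w) = - (toC e * evalC a z) by rewrite Ea opprK.
  by ring.
have := cabsD (t.[z] * toC (1 - e * c)) (- (toC e * P.[z])).
rewrite -zt !cabsN !cabsM !cabs_toC cabsJ.
have -> : cabs w = 1 by rewrite /cabs w1.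
rewrite mul1r ger0_norm ?gtr0_norm //; last by lra.
have := cabs_ge0 P.[z]; move: (cabs P.[z]) (cabs t.[z]) (cabs t.[w]) (cabs z) hP tz z1 tw_gt0.
move=> {}P' T T0 Z h1 h2 h3 h4 h5 h6.
have h7 : P' < c * T / 2 by nra.
have h8 : e * P' < e * (c * T / 2) by rewrite ltr_pM2l.
have h9 : T <= Z * T by nra.
have h10 : 0 < e * c * T by rewrite !mulr_gt0 //; lra.
by clear - h6 h8 h9 h10; lra.
Qed.

Lemma local_root w : cabs w <= 1 -> root (polyC_of b) w ->
  (`|w| = 1 -> 0 < evalC a w / evalC b^`() w * w^*) ->
  exists d e1 : R, [/\ 0 < d, 0 < e1 & forall (e : R) z, 0 < e < e1 ->
    cabs (z - w) < d -> 1 <= cabs z -> evalC b z + toC e * evalC a z != 0].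
Proof.
rewrite le_eqVlt => /orP[/eqP w1|w1] rw hw.
  have w1' : `|w| = 1 by rewrite cabsE w1.
  by apply: local_boundary_root => //; apply: hw.
exists (1 - cabs w), 1; split; rewrite ?ltr01 ?subr_gt0 // => e z _ h1 h2.
by have := cabsD (z - w) w; rewrite subrK; lra.
Qed.

Lemma uniform_local (s : seq R[i]) (P : R -> R[i] -> Prop) :
  (forall w, w \in s -> exists d e1 : R, [/\ 0 < d, 0 < e1 & forall (e : R) z, 0 < e < e1 ->
    cabs (z - w) < d -> P e z]) ->
  exists d e1 : R, [/\ 0 < d, 0 < e1 & forall w (e : R) z, w \in s -> 0 < e < e1 ->
    cabs (z - w) < d -> P e z].
Proof.
elim: s => [|w s IH] h; first by exists 1, 1; split; rewrite ?ltr01.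
have [|d [e1 [d0 e10 h1]]] := IH.
  by move=> v vs; apply: h; rewrite inE vs orbT.
have [d' [e1' [d0' e10' h1']]] := h w (mem_head _ _).
exists (Num.min d d'), (Num.min e1 e1'); split; rewrite ?lt_min ?d0 ?e10 //.
move=> v e z; rewrite inE !lt_min => /orP[/eqP->|vs] /and3P[p1 p2 p3] /andP[p4 p5].
  by apply: h1' => //; rewrite p1.
by apply: (h1 v) => //; rewrite p1.
Qed.

Hypothesis (outside : forall z, 1 < cabs z -> evalC b z != 0)
  (boundary : forall w, root (polyC_of b) w -> `|w| = 1 ->
     0 < evalC a w / evalC b^`() w * w^*).

(** Outside the discs controlled by [local_root], |z - w| is at least a fixed
multiple of 1 + |z| for each root w of [b], so |b(z)| dominates a multiple of
(1 + |z|)^r and hence e |a(z)| for small e. This treats bounded and unbounded z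
at once, so that no compactness is involved. *)
Lemma perturbed_stable : exists2 e0 : R, 0 < e0 & forall e, 0 < e < e0 ->
  size (b + e *: a) = r.+1 /\
  forall z, root (polyC_of (b + e *: a)) z -> cabs z < 1.
Proof.
have [s bE] := closed_field_poly_normal (polyC_of b).
set lc := lead_coef _ in bE.
have b0 : b != 0 by rewrite -size_poly_eq0 sb.
have lc0 : 0 < cabs lc by rewrite cabs_gt0 lead_coef_eq0 map_poly_eq0.
have ss : size s = r.
  have := congr1 (fun p : {poly R[i]} => size p) bE.
  by rewrite size_map_poly sb size_scale -?cabs_gt0 // size_prod_XsubC => -[].
have rs w : w \in s -> root (polyC_of b) w.
  by move=> ws; rewrite bE rootZ -?cabs_gt0 // root_prod_XsubC.
have s1 w : w \in s -> cabs w <= 1.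
  move=> /rs rw; rewrite leNgt; apply/negP => /outside.
  by rewrite /evalC (rootP rw) eqxx.
have [d [e1 [d0 e10 near]]] := @uniform_local s
   (fun e z => 1 <= cabs z -> evalC b z + toC e * evalC a z != 0)
   (fun w ws => local_root (s1 w ws) (rs w ws) (boundary (rs w ws))).
(* If |w| <= 1 and |z - w| >= d then 1 + |z| <= 2 + |z - w|, whence
   |z - w| >= eta (1 + |z|). *)
pose eta := d / (d + 2).
have d2 : 0 < d + 2 by lra.
have eta0 : 0 < eta by rewrite divr_gt0.
pose K := \sum_(i < r.+1) cabs (polyC_of a)`_i.
have K0 : 0 <= K by rewrite sumr_ge0 // => i _; rewrite cabs_ge0.
have m0 : 0 < cabs lc * eta ^+ r by rewrite mulr_gt0 // exprn_gt0.
have br0 : b`_r != 0.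
  by rewrite -[r]/(r.+1.-1) -sb -/(lead_coef b) lead_coef_eq0.
have e3p : 0 < `|b`_r| / (`|a`_r| + 1).
  by rewrite divr_gt0 ?normr_gt0 // ltr_wpDl.
exists (Num.min e1 (Num.min (cabs lc * eta ^+ r / (K + 1)) (`|b`_r| / (`|a`_r| + 1)))).
  by rewrite !lt_min e10 e3p andbT /= divr_gt0 //; lra.
move=> e /andP[e0]; rewrite !lt_min => /and3P[ee1 eK ea].
rewrite ltr_pdivlMr in eK; last by lra.
rewrite ltr_pdivlMr in ea; last by rewrite ltr_wpDl.
split.
  apply/eqP; rewrite eqn_leq; apply/andP; split.
    rewrite (leq_trans (size_polyD _ _)) // geq_max sb leqnn /=.
    by rewrite (leq_trans (size_scale_leq _ _)).
  rewrite ltnNge; apply/negP => h.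
  have /eqP : (b + e *: a)`_r = 0 by rewrite nth_default.
  rewrite coefD coefZ addr_eq0 => /eqP e'; move: ea; rewrite e' normrN normrM.
  by rewrite gtr0_norm //; have := normr_ge0 a`_r; nra.
move=> z /rootP; rewrite -/(evalC _ z) evalCD evalCZ => E.
rewrite ltNge; apply/negP => z1.
have far w : w \in s -> eta * (1 + cabs z) <= cabs (z - w).
  move=> ws; have dz : d <= cabs (z - w).
    rewrite leNgt; apply/negP => h.
    have := near w e z ws _ h z1; rewrite e0 ee1 E eqxx => /(_ isT); done.
  have zw : cabs z <= cabs (z - w) + cabs w by rewrite -{1}(subrK w z) cabsD.
  have w1 := s1 w ws.
  by rewrite /eta mulrAC ler_pdivrMr //; nra.
have bz : cabs lc * (eta ^+ r * (1 + cabs z) ^+ r) <= cabs (evalC b z).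
  rewrite /evalC -/(polyC_of b) bE hornerZ cabsM ler_wpM2l ?cabs_ge0 //.
  rewrite -exprMn -ss horner_prod; elim: (s) far => [|w s' IH] far.
    by rewrite big_nil cabs1 expr0.
  rewrite big_cons cabsM /= exprS hornerXsubC ler_pM ?far ?mem_head //.
  - by rewrite mulr_ge0 ?addr_ge0 ?cabs_ge0 // ltW.
  - by rewrite exprn_ge0 // mulr_ge0 ?addr_ge0 ?cabs_ge0 // ltW.
  - by apply: IH => v vs; rewrite far // inE vs orbT.
have A1 : 1 <= 1 + cabs z by rewrite lerDl cabs_ge0.
have az : cabs (evalC a z) <= K * (1 + cabs z) ^+ r.
  by apply: horner_bound => //; [rewrite size_map_poly | rewrite lerDr].
have ba : cabs (evalC b z) = e * cabs (evalC a z).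
  move/eqP: E; rewrite addr_eq0 => /eqP ->.
  by rewrite cabsN cabsM cabs_toC gtr0_norm.
have Ap : 0 < (1 + cabs z) ^+ r by rewrite exprn_gt0 //; lra.
move: bz; rewrite ba mulrA leNgt => /negP; apply.
apply: (@le_lt_trans _ _ (e * (K * (1 + cabs z) ^+ r))); first by rewrite ler_pM2l.
rewrite mulrA ltr_pM2r //; apply: le_lt_trans eK; rewrite ler_pM2l //; lra.
Qed.

End Perturbation.

Section BoundarySpectral.
Variable R : realType.

Lemma coprime_eval (a b : {poly R}) (z : R[i]) : coprimep a b ->
  0 < evalC a z * (evalC a z)^* + evalC b z * (evalC b z)^*.
Proof.
move=> cop; rewrite -!normCK; have na := normr_ge0 (evalC a z).
have nb := normr_ge0 (evalC b z).
have [a0|a0] := eqVneq (evalC a z) 0; last first.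
  by rewrite ltr_wpDr ?exprn_ge0 // exprn_gt0 // normr_gt0.
rewrite ltr_wpDl ?exprn_ge0 // exprn_gt0 // normr_gt0.
move: cop; rewrite -(coprimep_map (real_complex R)).
by move=> /Pdiv.ClosedField.coprimepP; apply; apply/rootP.
Qed.

(** Replace (a, b) by (a + e b, b + e a). The new [b] is stable by
[perturbed_stable]. On the circle the real part to be bounded below becomes
(1 + e^2) (a conj b + b conj a) + 2 e (|a|^2 + |b|^2), which strictly exceeds
the lambda term as [a] and [b] have no common zero. Then let e tend to 0. *)
Lemma boundary_spectral r (a b l : {poly R}) (c : R) :
  (size a <= r.+1)%N -> size b = r.+1 -> (size l <= r.+1)%N -> 0 <= c ->
  coprimep a b ->
  (forall z : R[i], 1 < cabs z -> evalC b z != 0) ->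
  (forall z : R[i], `|z| = 1 ->
     toC c * (evalC l z * (evalC l z)^*) <=
       evalC a z * (evalC b z)^* + evalC b z * (evalC a z)^*) ->
  (forall z : R[i], root (polyC_of b) z -> `|z| = 1 ->
     0 < evalC a z / evalC b^`() z * z^*) ->
  exists2 q : {poly R}, (size q <= r.+1)%N &
    spectral r (residual_kernel (nth 0 a) (nth 0 b) (nth 0 l) c (nth 0 q)).
Proof.
move=> sa sb sl c0 cop outside circle poles.
have [e0 e0p he] := perturbed_stable sa sb outside poles.
pose e n : R := e0 / 2 * n.+1%:R^-1.
have ep n : 0 < e n by rewrite /e mulr_gt0 ?invr_gt0 ?ltr0n // divr_gt0.
have elt n : e n < e0.
  have : n.+1%:R^-1 <= 1 :> R by rewrite invf_le1 ?ltr0n // ler1n.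
  by move=> h; apply: (@le_lt_trans _ _ (e0 / 2)); [rewrite ler_piMr // | ]; lra.
have ce : (e n @[n --> \oo] --> (0 : R))%classic.
  rewrite -(mulr0 (e0 / 2)); apply: cvgM; first exact: cvg_cst.
  exact: cvg_harmonic.
have strict n := he (e n) (introT andP (conj (ep n) (elt n))).
have spec n : exists q : {poly R}, (size q <= r.+1)%N /\
    spectral r (residual_kernel (nth 0 (a + e n *: b)) (nth 0 (b + e n *: a)) (nth 0 l) c (nth 0 q)).
  have [sbe stab] := strict n.
  have sae : (size (a + e n *: b)%R <= r.+1)%N.
    rewrite (leq_trans (size_polyD _ _)) // geq_max sa /=.
    by rewrite (leq_trans (size_scale_leq _ _)) // sb.
  have [|q sq hq] := strict_spectral sae sbe sl c0 _ stab; last by exists q.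
  move=> z z1; rewrite !evalCD !evalCZ.
  set A := evalC a z; set B := evalC b z; set L := evalC l z.
  rewrite !rmorphD !rmorphM /= !toCJ; set E := toC (e n).
  have Ep : 0 < E by rewrite /E -[0]/(toC (0 : R)) ltcR.
  have c0' : 0 <= toC c by rewrite -[0]/(toC (0 : R)) lecR.
  (* The last summand is positive by coprimality, the others are nonnegative. *)
  have -> : (A + E * B) * (B^* + E * A^*) + (B + E * A) * (A^* + E * B^*) -
     toC c * (L * L^*) = (1 + E * E) * (A * B^* + B * A^* - toC c * (L * L^*))
     + E * E * (toC c * (L * L^*)) + 2 * E * (A * A^* + B * B^*) by ring.
  rewrite ltr_wpDl //; last by rewrite !mulr_gt0 ?ltr0n // coprime_eval.
  have E0 := ltW Ep; have EE : 0 <= E * E by rewrite mulr_ge0.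
  apply: addr_ge0; last by rewrite mulr_ge0 // mulr_ge0 // mul_conjC_ge0.
  by rewrite mulr_ge0 ?subr_ge0 ?circle // addr_ge0.
pose qn n := sval (cid (spec n)).
have [sqn hqn] : (forall n, (size (qn n) <= r.+1)%N) /\ forall n, spectral r
   (residual_kernel (nth 0 (a + e n *: b)) (nth 0 (b + e n *: a)) (nth 0 l) c (nth 0 (qn n))).
  by split=> n; have [] := svalP (cid (spec n)).
have := @spectral_limit R r
  (fun n i j => (a + e n *: b)`_i * (b + e n *: a)`_j
     + (b + e n *: a)`_i * (a + e n *: b)`_j - c * l`_i * l`_j)
  (fun i j => a`_i * b`_j + b`_i * a`_j - c * l`_i * l`_j) qn _ sqn hqn.
apply=> i j.
have cc (f g : {poly R}) k : (((f + e n *: g)`_k) @[n --> \oo] --> f`_k)%classic.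
  under eq_fun do rewrite coefD coefZ.
  suff h : ((f`_k + e n * g`_k) @[n --> \oo] --> f`_k + 0 * g`_k)%classic.
    by move: h; rewrite mul0r addr0.
  apply: cvgD; first exact: cvg_cst.
  by apply: cvgM => //; exact: cvg_cst.
apply: cvgB; last exact: cvg_cst.
by apply: cvgD; apply: cvgM; apply: cc.
Qed.

End BoundarySpectral.

(** * Cholesky factorization and the bordered matrices *)
Section Matrices.
Variable R : realType.

Definition has_cholesky n (G : 'M[R]_n) : Prop :=
  exists2 U : 'M[R]_n, U \in unitmx & G = U^T *m U.

(** Eliminating the first variable leaves the form of the Schur complement [S],
which is positive definite because t below is the minimizing first coordinate
for given y. *)
Lemma cholesky_step n (G : 'M[R]_(1 + n)) :
  (forall D : 'M[R]_n, posdefmx D -> has_cholesky D) ->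
  posdefmx G -> has_cholesky G.
Proof.
move=> IH [Gs Gp].
pose b := ursubmx G; pose D := drsubmx G; pose a := ulsubmx G 0 0.
have GE : G = block_mx a%:M b b^T D.
  by rewrite -[LHS]submxK /b trmx_ursub Gs -mx11_scalar.
have Ds : D^T = D by rewrite /D trmx_drsub Gs.
have form (t : R) (y : 'cV[R]_n) :
   ((col_mx t%:M y)^T *m G *m col_mx (t%:M : 'M_1) y) 0 0 =
   a * t ^+ 2 + 2 * t * (b *m y) 0 0 + (y^T *m D *m y) 0 0.
  rewrite GE tr_col_mx mul_row_block mul_row_col !mulmxDl tr_scalar_mx.
  rewrite !mul_scalar_mx !mul_mx_scalar -!scalemxAl.
  have -> : y^T *m b^T = b *m y.
    by rewrite -trmx_mul [b *m y]mx11_scalar tr_scalar_mx.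
  by rewrite !mxE /= mulr1n; ring.
have a0 : 0 < a.
  have := Gp (col_mx (1%:M : 'M_1) (0 : 'cV[R]_n)).
  rewrite form expr1n !mulmx0 !mxE !mulr1 mulr0 !addr0; apply.
  apply/eqP => /(congr1 usubmx); rewrite col_mxKu linear0 => /matrixP/(_ 0 0).
  by rewrite !mxE => /eqP; rewrite oner_eq0.
pose S := D - a^-1 *: (b^T *m b).
have [|L Lu SE] := IH S.
  split; first by rewrite /S linearB linearZ /= trmx_mul trmxK Ds.
  move=> y y0; pose t := - a^-1 * (b *m y) 0 0.
  have := Gp (col_mx t%:M y); rewrite form.
  have -> : a * t ^+ 2 + 2 * t * (b *m y) 0 0 + (y^T *m D *m y) 0 0 =
     (y^T *m S *m y) 0 0.
    have [w byE] : exists w, b *m y = w%:M.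
      by exists ((b *m y) 0 0); rewrite -mx11_scalar.
    have -> : y^T *m S *m y = y^T *m D *m y - a^-1 *: ((b *m y)^T *m (b *m y)).
      by rewrite /S mulmxBr mulmxBl -scalemxAr -scalemxAl trmx_mul !mulmxA.
    rewrite /t byE tr_scalar_mx -scalar_mxM; set Dy := y^T *m D *m y.
    by rewrite !mxE eqxx !mulr1n; field; rewrite gt_eqF.
  apply; apply: contraNneq y0 => /(congr1 dsubmx).
  by rewrite col_mxKd linear0 => ->.
have sa0 : Num.sqrt a != 0 by rewrite gt_eqF // sqrtr_gt0.
have saa : Num.sqrt a * Num.sqrt a = a by rewrite -expr2 sqr_sqrtr // ltW.
exists (block_mx (Num.sqrt a)%:M ((Num.sqrt a)^-1 *: b) 0 L).
  rewrite unitmxE det_ublock det_scalar1 unitrM -unitmxE Lu andbT.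
  by rewrite unitfE.
rewrite tr_block_mx mulmx_block tr_scalar_mx !trmx0 !mul0mx !mulmx0 !addr0.
rewrite {1}GE; congr block_mx.
- by rewrite -scalar_mxM saa.
- by rewrite -scalemxAr mul_scalar_mx scalerA mulVf // scale1r.
- by rewrite mul_mx_scalar linearZ scalerA divff // scale1r.
- rewrite [(_ *: b)^T]linearZ /= -scalemxAl -scalemxAr scalerA -invfM saa -SE /S addrC.
  by rewrite subrK.
Qed.

Lemma cholesky n (G : 'M[R]_n) : posdefmx G -> has_cholesky G.
Proof.
elim: n G => [|n IH] G Gp.
  by exists 0; [rewrite unitmxE det_mx00 unitr1 | apply/matrixP => -[]].
exact: (@cholesky_step n G IH Gp).
Qed.

Lemma bordered_brE r (f : nat -> nat -> R) (i j : 'I_r.+1) :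
  bordered_br (\matrix_(k < r, m < r) f k m) i j =
  if (i < r)%N && (j < r)%N then f i j else 0.
Proof.
rewrite /bordered_br castmxE /= block_mxEv !mxE.
case: splitP => k /= ->; rewrite !mxE; case: splitP => m /= ->; rewrite !mxE.
- by rewrite !ltn_ord.
- by rewrite [(r + _ < r)%N]ltnNge leq_addr andbF.
- by rewrite [(r + _ < r)%N]ltnNge leq_addr.
- by rewrite [(r + _ < r)%N]ltnNge leq_addr.
Qed.

Lemma bordered_ulE r (f : nat -> nat -> R) (i j : 'I_r.+1) :
  bordered_ul (\matrix_(k < r, m < r) f k m) i j =
  if (0 < i)%N && (0 < j)%N then f i.-1 j.-1 else 0.
Proof.
rewrite /bordered_ul block_mxEv !mxE.
case: splitP => k /= ->; rewrite !mxE; case: splitP => m /= ->; rewrite !mxE.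
- by rewrite ord1.
- by rewrite ord1.
- by rewrite (ord1 m).
- by [].
Qed.

Lemma coef_eq0_of_eval n (c : nat -> R) :
  (forall t : R, \sum_(i < n) c i * t ^+ i = 0) ->
  forall i, (i < n)%N -> c i = 0.
Proof.
move=> h i iltn; have : \poly_(i < n) c i = 0.
  apply: (@roots_geq_poly_eq0 _ _ [seq k%:R | k <- iota 0 n]).
  - by apply/allP => _ /mapP[k _ ->]; rewrite /root horner_poly h.
  - by rewrite map_inj_uniq ?iota_uniq // => x y /eqP; rewrite eqr_nat => /eqP.
  - by rewrite size_map size_iota size_poly.
by move=> /polyP /(_ i); rewrite coef_poly iltn coef0.
Qed.

(** A bivariate polynomial that vanishes at all real points is zero. *)
Lemma coef2_eq0_of_eval n (A : nat -> nat -> R) :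
  (forall s t : R, \sum_(i < n) \sum_(j < n) A i j * (s ^+ i * t ^+ j) = 0) ->
  forall i j, (i < n)%N -> (j < n)%N -> A i j = 0.
Proof.
move=> h i j iltn jltn.
apply: (@coef_eq0_of_eval n (fun j => A i j)) => // t.
apply: (@coef_eq0_of_eval n (fun i => \sum_(j < n) A i j * t ^+ j)) => // s.
rewrite -[RHS](h s t); apply: eq_bigr => k _; rewrite mulr_suml.
by apply: eq_bigr => m _; ring.
Qed.

End Matrices.

(** * Zeros of sigma under a sign condition outside the open disc *)
Section LocalSign.
Variable R : realType.
Implicit Types (z w d e : R[i]).
Local Notation re := (@complex.Re R).

(** For m >= 2 the m-th roots of [w] add up to zero, by the vanishing of the
coefficient of X^(m-1) in X^m - w, so their real parts cannot all be
negative. *)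
Lemma root_Re_ge0 m w : (1 < m)%N -> exists2 e, e ^+ m = w & 0 <= re e.
Proof.
move=> m1; have m0 : (0 < m)%N by apply: ltnW.
have mon : 'X^m - w%:P \is monic by apply: monicXnsubC.
have [s sE] := closed_field_poly_normal ('X^m - w%:P).
move: sE; rewrite (monicP mon) scale1r => sE.
have ss : size s = m.
  have := congr1 (fun p : {poly R[i]} => size p) sE.
  by rewrite size_XnsubC // size_prod_XsubC => -[].
have rt e : e \in s -> e ^+ m = w.
  rewrite -root_prod_XsubC -sE /root !hornerE => /eqP h.
  by apply/eqP; rewrite -subr_eq0 h.
have sum0 : \sum_(e <- s) e = 0.
  have := @coefPn_prod_XsubC _ s; rewrite ss => /(_ (lt0n_neq0 m0)); rewrite -sE.
  rewrite coefB coefXn coefC; have -> : (m.-1 == m) = false by lia.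
  have -> : (m.-1 == 0)%N = false by lia.
  by rewrite subrr => /eqP; rewrite eq_sym oppr_eq0 => /eqP.
have [/hasP[e es eR]|/hasPn allneg] := boolP (has (fun e => 0 <= re e) s).
  by exists e => //; apply: rt.
exfalso; have : re (\sum_(e <- s) e) < 0.
  have : s != [::] by rewrite -size_eq0 ss -lt0n.
  elim: (s) allneg => // e s' IH allneg _; rewrite big_cons raddfD /=.
  have e0 : re e < 0 by rewrite ltNge; apply: allneg; rewrite mem_head.
  have [->|s'0] := eqVneq s' [::]; first by rewrite big_nil addr0.
  have := IH (fun x xs => allneg x (mem_behead (s := e :: s') xs)) s'0; lra.
by rewrite sum0 ltxx.
Qed.

(** Along a ray with real parameter t, conjugation of z + t d is polynomial in
t, so A(z + t d) conj(B(z + t d)) is a polynomial in t, and continuity of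
polynomials is all the analysis that boundary arguments require. *)
Lemma horner_ray (A B : {poly R[i]}) z d : exists P : {poly R[i]},
  forall t : R, P.[toC t] = A.[z + toC t * d] * (B.[z + toC t * d])^*.
Proof.
exists ((A \Po (d *: 'X + z%:P))
  * (map_poly Num.conj B \Po (d^* *: 'X + (z^*)%:P))) => t.
rewrite hornerM !horner_comp !hornerD !hornerZ !hornerX !hornerC.
have -> : d^* * toC t + z^* = (z + toC t * d)^*.
  by rewrite rmorphD rmorphM /= toCJ; ring.
by rewrite horner_map /= (mulrC d) [_ + z]addrC.
Qed.

Lemma re_horner0_ge0 (P : {poly R[i]}) (t0 : R) : 0 < t0 ->
  (forall t : R, 0 < t < t0 -> 0 <= re P.[toC t]) -> 0 <= re P.[0].
Proof.
move=> t00 pos; rewrite leNgt; apply/negP => neg.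
have e0 : 0 < - re P.[0] by rewrite oppr_gt0.
have [dd dd0 hd] := horner_continuous P 0 e0.
pose t := Num.min t0 dd / 2.
have mp : 0 < Num.min t0 dd by rewrite lt_min t00.
have tp : 0 < t by rewrite /t; lra.
have /andP[tt0 tdd] : (t < t0) && (t < dd) by rewrite -lt_min /t; lra.
have := hd (toC t); rewrite subr0 cabs_toC gtr0_norm // => /(_ tdd) h.
have := le_lt_trans (Re_le_cabs _) h; rewrite raddfB /= ltr_norml => /andP[_].
have := pos t; rewrite tp tt0 => /(_ isT); lra.
Qed.

(** With B = T (X - z0)^m, the product A conj(B) at z0 + t d is t^m times
A conj(T) conj(d)^m; divide by t^m and let t tend to 0. *)
Lemma sign_along_direction (A B : {poly R[i]}) z0 (m : nat) (T : {poly R[i]}) d (t0 : R) :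
  (forall z, 1 <= cabs z -> 0 <= re (A.[z] * (B.[z])^*)) ->
  B = T * ('X - z0%:P) ^+ m -> 0 < t0 ->
  (forall t : R, 0 < t < t0 -> 1 <= cabs (z0 + toC t * d)) ->
  0 <= re (A.[z0] * T.[z0]^* * d^* ^+ m).
Proof.
move=> pos BE t00 out; have [P PE] := horner_ray A T z0 d.
have P0 : P.[0] = A.[z0] * T.[z0]^*.
  by have := PE 0; rewrite /toC rmorph0 mul0r addr0.
have := @re_horner0_ge0 (P * (d^* ^+ m)%:P) t0 t00.
rewrite hornerM hornerC P0; apply=> t /andP[tp tt0].
have := pos (z0 + toC t * d); rewrite out ?tp // => /(_ isT).
rewrite BE !hornerM horner_exp hornerXsubC hornerC PE.
have -> : z0 + toC t * d - z0 = toC t * d by ring.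
set v := A.[_] * _ * _.
have -> : A.[z0 + toC t * d] * (T.[z0 + toC t * d] * (toC t * d) ^+ m)^* =
    toC (t ^+ m) * v.
  by rewrite /v rmorphM rmorphXn rmorphM /= toCJ exprMn /toC rmorphXn /=; ring.
have -> : re (toC (t ^+ m) * v) = t ^+ m * re v.
  by case: (v) => x y /=; rewrite mul0r subr0.
by rewrite pmulr_rge0 ?exprn_gt0.
Qed.

Section RootsOfSigma.
Variables A B : {poly R[i]}.
Hypotheses (pos : forall z, 1 <= cabs z -> 0 <= re (A.[z] * (B.[z])^*))
  (B0 : B != 0) (cop : coprimep A B).

Lemma re_mul_conj_lt0 z : z != 0 -> re (z * (- z)^*) < 0.
Proof.
move=> z0; rewrite rmorphN mulrN -cabs_sqr raddfN /= oppr_lt0.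
by rewrite exprn_gt0 // cabs_gt0.
Qed.

(** Around an exterior zero every direction is admissible, so the direction can
be chosen to make the leading term of A conj(B) negative. *)
Lemma no_root_outside z0 : 1 < cabs z0 -> ~~ root B z0.
Proof.
move=> z01; apply/negP => rz0.
have Az0 : A.[z0] != 0.
  by move: cop; rewrite coprimep_sym => /Pdiv.ClosedField.coprimepP; apply.
have [m [T + BE]] := multiplicity_XsubC B z0; rewrite B0 /= => nT.
have m0 : (0 < m)%N.
  by rewrite lt0n; apply: contraNneq nT => m0; move: rz0; rewrite BE m0 mulr1.
pose k := A.[z0] * T.[z0]^*.
have k0 : k != 0 by rewrite mulf_neq0 // conjC_eq0.
pose d := m.-root (- k).
have d1 : 0 < cabs d + 1 by rewrite ltr_wpDl ?cabs_ge0.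
have t00 : 0 < (cabs z0 - 1) / (cabs d + 1) by rewrite divr_gt0 // subr_gt0.
have := sign_along_direction (d := d) pos BE t00.
rewrite -/k -rmorphXn rootCK // => h.
have : 0 <= re (k * (- k)^*).
  apply: h => t /andP[t0]; rewrite ltr_pdivlMr // => tt.
  have := cabsB z0 (- (toC t * d)); rewrite opprK cabsN cabsM cabs_toC gtr0_norm //.
  have := cabs_ge0 d; nra.
by rewrite leNgt re_mul_conj_lt0.
Qed.

(** At a zero on the circle the directions z0 e with Re e >= 0 are admissible. If
the multiplicity m is at least 2, some such e makes the leading term negative
by [root_Re_ge0]. For m = 1 the directions e = 1, i, -i show that
A(z0) conj(T(z0) z0) is real and positive, where T(z0) = B'(z0). *)
Lemma boundary_root_simple z0 : cabs z0 = 1 -> root B z0 ->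
  mup z0 B = 1 /\ 0 < A.[z0] / B^`().[z0] * z0^*.
Proof.
move=> z01 rz0.
have Az0 : A.[z0] != 0.
  by move: cop; rewrite coprimep_sym => /Pdiv.ClosedField.coprimepP; apply.
have [m [T + BE]] := multiplicity_XsubC B z0; rewrite B0 /= => nT.
have m0 : (0 < m)%N.
  by rewrite lt0n; apply: contraNneq nT => m0; move: rz0; rewrite BE m0 mulr1.
have zz : z0 * z0^* = 1 by rewrite -cabs_sqr z01 expr1n.
have z0n : z0^* != 0 by rewrite conjC_eq0 -cabs_eq0 z01 oner_eq0.
pose k := A.[z0] * T.[z0]^* * z0^* ^+ m.
have k0 : k != 0 by rewrite !mulf_neq0 ?expf_neq0 // conjC_eq0.
have dir e : 0 <= re e -> 0 <= re (k * (e^*) ^+ m).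
  move=> e0; have := sign_along_direction (d := z0 * e) pos BE (ltr01 : 0 < 1 :> R).
  rewrite rmorphM exprMn mulrA; apply => t /andP[t0 _].
  have -> : z0 + toC t * (z0 * e) = z0 * (1 + toC t * e) by ring.
  rewrite cabsM z01 mul1r; apply: le_trans (Re_le_cabs _).
  have -> : re (1 + toC t * e) = 1 + t * re e.
    by case: (e) => x y /=; rewrite mul0r subr0.
  by rewrite ger0_norm; have := mulr_ge0 (ltW t0) e0; lra.
have m1 : m = 1.
  apply/eqP; rewrite eqn_leq m0 andbT leqNgt; apply/negP => m1.
  have [e em e0] := root_Re_ge0 (- k) m1.
  by have := dir e e0; rewrite -rmorphXn /= em leNgt re_mul_conj_lt0.
rewrite m1 expr1 in BE; split.
  by rewrite BE mupMr // -[_ - _]expr1 mup_XsubCX eqxx.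
have BT : B^`().[z0] = T.[z0].
  rewrite BE derivM derivXsubC mulr1 hornerD hornerM hornerXsubC subrr mulr0.
  by rewrite add0r.
have kpos : 0 < k.
  have := dir 1 ler01; have := dir 'i%C (lexx _); have := dir (- 'i%C); move: k0.
  rewrite m1 !expr1 /=; case: (k) => x y.
  rewrite rmorph1 mulr1 /= => k0 h1 h2 h3.
  have y0 : y = 0 by have := h1 ltac:(by rewrite oppr0); lra.
  rewrite y0 in k0 *; rewrite ltcE /= eqxx lt0r h3 andbT.
  by apply: contraNneq k0 => ->; rewrite eq_complex /= eqxx.
rewrite BT; have -> : A.[z0] / T.[z0] * z0^* = k / (T.[z0] * T.[z0]^*).
  rewrite /k m1 expr1; field; rewrite conjC_eq0; exact/andP.
rewrite divr_gt0 // -normCK exprn_gt0 // normr_gt0 //.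
Qed.

End RootsOfSigma.
End LocalSign.

(** * The representations (iv) and (v) *)
Section Statements.
Variables (R : realType) (r : nat) (rho sigma lambda : {poly R}) (gamma : R).

Definition square_repr : Prop :=
  exists (p : r.-tuple {poly_r R}) (q : {poly R}),
    [/\ free p, (size q <= r.+1)%N
      & forall z w : R[i],
          evalC rho z * evalC sigma w + evalC rho w * evalC sigma z
            - 2 * toC gamma * evalC lambda z * evalC lambda w
          = evalC q z * evalC q w
            + (z * w - 1) * \sum_(j < r)
                evalC (tnth p j) z * evalC (tnth p j) w].

Definition matrix_repr : Prop :=
  exists (q : 'cV[R]_r.+1) (G : 'M[R]_r),
    posdefmx G /\
    coefvec r rho *m (coefvec r sigma)^T
      + coefvec r sigma *m (coefvec r rho)^T
      - (2 * gamma) *: (coefvec r lambda *m (coefvec r lambda)^T)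
    = q *m q^T + bordered_br G - bordered_ul G.

End Statements.

Section Coefficients.
Variables (R : realType) (r : nat).
Local Notation re := (@complex.Re R).

Lemma re_toC_mul (x : R) z : re (toC x * z) = x * re z.
Proof. by case: z => a b /=; rewrite mul0r subr0. Qed.

Lemma re_mul_conj (a s : R[i]) : s != 0 -> re (a * s^*) = cabs s ^+ 2 * re (a / s).
Proof.
move=> s0; rewrite -re_toC_mul cabs_sqr; congr (re _).
by field.
Qed.

Lemma strict_quotient (g : R) (a l s : R[i]) : s != 0 ->
  (g * cabs (l / s) ^+ 2 < re (a / s)) = (g * cabs l ^+ 2 < re (a * s^*)).
Proof.
move=> s0; have cs : 0 < cabs s ^+ 2 by rewrite exprn_gt0 // cabs_gt0.
rewrite re_mul_conj // -(ltr_pM2l cs); congr (_ < _).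
by rewrite mulrCA -exprMn -cabsM [s * _]mulrC divfK.
Qed.

Lemma ltC_Re (g : R) (l v : R[i]) :
  (toC g * `|l| ^+ 2 < 'Re v) = (g * cabs l ^+ 2 < re v).
Proof. by rewrite -complexRe cabsE /toC -rmorphXn -rmorphM ltcR. Qed.

Lemma leC_Re (g : R) (l v : R[i]) :
  (toC g * `|l| ^+ 2 <= 'Re v) = (g * cabs l ^+ 2 <= re v).
Proof. by rewrite -complexRe cabsE /toC -rmorphXn -rmorphM lecR. Qed.

Lemma addcJ_Re (v : R[i]) : v + v^* = toC (2 * re v).
Proof. by rewrite addcJ /toC rmorphM rmorph_nat. Qed.

Lemma quad_mxE n (G : 'M[R]_n) (x : 'cV[R]_n) :
  (x^T *m G *m x) 0 0 = \sum_i \sum_j G i j * (x i 0 * x j 0).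
Proof.
rewrite exchange_big mxE; apply: eq_bigr => j _ /=.
rewrite mxE mulr_suml; apply: eq_bigr => i _.
by rewrite mxE; ring.
Qed.

Lemma posdef_gram n (W : 'M[R]_n) : W \in unitmx -> posdefmx (W^T *m W).
Proof.
move=> Wu; split; first by rewrite trmx_mul trmxK.
move=> x x0; have -> : x^T *m (W^T *m W) *m x = (W *m x)^T *m (W *m x).
  by rewrite trmx_mul !mulmxA.
have y0 : W *m x != 0.
  by apply: contraNneq x0 => e; rewrite -[x](mulKmx Wu) e mulmx0.
rewrite mxE; move: (W *m x) y0 => y y0; rewrite lt_neqAle eq_sym.
have sq i : 0 <= y^T 0 i * y i 0 by rewrite mxE -expr2 sqr_ge0.
rewrite sumr_ge0 // andbT psumr_eq0 //; apply: contraNN y0 => /allP y0.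
apply/eqP/matrixP => i j; rewrite ord1 [RHS]mxE; apply/eqP.
by have := y0 i (mem_index_enum _); rewrite mxE mulf_eq0 orbb.
Qed.

Lemma posdef_rev n (G : 'M[R]_n) : posdefmx G ->
  posdefmx (\matrix_(i, j) G (rev_ord i) (rev_ord j)).
Proof.
move=> [Gs Gp]; split.
  by apply/matrixP => i j; rewrite !mxE -[in LHS]Gs mxE.
move=> x x0; pose y := \col_i x (rev_ord i) 0.
have y0 : y != 0.
  apply: contraNneq x0 => /colP e; apply/eqP/colP => i.
  by have := e (rev_ord i); rewrite !mxE rev_ordK.
have := Gp y y0; rewrite !quad_mxE; congr (0 < _).
rewrite (reindex_inj rev_ord_inj) /=; apply: eq_bigr => i _.
rewrite (reindex_inj rev_ord_inj) /=; apply: eq_bigr => j _.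
by rewrite !mxE !rev_ordK.
Qed.

Definition coefmx (p : r.-tuple {poly_r R}) : 'M[R]_r :=
  \matrix_(k, i) (tnth p k : {poly R})`_i.

(** r polynomials of degree less than r are independent iff they form a basis,
iff their square coefficient matrix is invertible. *)
Lemma free_coefmx (p : r.-tuple {poly_r R}) : free p = (coefmx p \in unitmx).
Proof.
have comb (k : 'I_r -> R) (i : 'I_r) :
    ((\sum_j k j *: p`_j : {poly_r R}) : {poly R})`_i
    = ((\row_j k j) *m coefmx p) 0 i.
  rewrite (raddf_sum (polyn (n:=r))) coef_sum mxE; apply: eq_bigr => j _.
  by rewrite /= coefZ !mxE (tnth_nth 0).
apply/freeP/idP => [h|U k k0 i].
  rewrite -row_free_unit; apply: inj_row_free => v v0; apply/rowP => i.
  rewrite mxE; apply: (h (v 0)); apply/npolyP => j.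
  have [jr|jr] := ltnP j r; last first.
    by rewrite !nth_default // (leq_trans (size_npoly _)).
  rewrite (comb (v 0) (Ordinal jr)).
  have -> : \row_j v 0 j = v by apply/rowP => m; rewrite mxE.
  by rewrite v0 mxE coef0.
have : (\row_j k j) *m coefmx p = 0.
  by apply/rowP => j; rewrite -comb k0 mxE coef0.
move=> /(congr1 (mulmxr (invmx (coefmx p)))) /=; rewrite mulmxK // mul0mx.
by move=> /rowP /(_ i); rewrite !mxE.
Qed.

Lemma mxE_addB (A B C : 'M[R]_r.+1) i j : (A + B - C) i j = A i j + (B i j - C i j).
Proof. by rewrite addrA !mxE. Qed.

(** The vectors of (v) list coefficients from the highest degree down, so the
entry (i, j) is the coefficient of z^(r-i) w^(r-j). *)
Lemma bordered_shift_kernel (g : nat -> nat -> R) (i j : 'I_r.+1) : (0 < r)%N ->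
  let G := \matrix_(k < r, m < r) g (r.-1 - k)%N (r.-1 - m)%N in
  bordered_br G i j - bordered_ul G i j = shift_kernel r g (r - i)%N (r - j)%N.
Proof.
move=> r0 /=; rewrite (bordered_brE (fun k m => g (r.-1 - k)%N (r.-1 - m)%N)).
rewrite (bordered_ulE (fun k m => g (r.-1 - k)%N (r.-1 - m)%N)) /shift_kernel !subn_gt0.
have pe (k : 'I_r.+1) : (r - k < r)%N = (0 < k)%N by case: k => k /= ?; lia.
have p1 (k : nat) : (r.-1 - k = (r - k).-1)%N by lia.
rewrite !pe !p1; congr (_ - _); case: ifP => // /andP[i0 j0].
by congr (g _ _); clear - i0 j0; lia.
Qed.

End Coefficients.

Section Representations.
Variables (R : realType) (r : nat) (rho sigma lambda : {poly R}) (gamma : R).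
Hypotheses (hr : (1 <= r)%N) (srho : size rho = r.+1) (ssigma : size sigma = r.+1)
  (slambda : (size lambda <= r.+1)%N).

Lemma evalC_real_sum (f : {poly R}) x : (size f <= r.+1)%N ->
  \sum_(i < r.+1) real_complex R f`_i * x ^+ i = evalC f x.
Proof. by move=> sf; rewrite (evalC_sum x sf). Qed.

Lemma sum_gram (p : r.-tuple {poly_r R}) (z w : R[i]) :
  \sum_(i < r) \sum_(j < r)
    toC (\sum_k (tnth p k : {poly R})`_i * (tnth p k : {poly R})`_j)
      * (z ^+ i.+1 * w ^+ j.+1 - z ^+ i * w ^+ j)
  = (z * w - 1) * \sum_(k < r) evalC (tnth p k) z * evalC (tnth p k) w.
Proof.
have -> : \sum_(k < r) evalC (tnth p k) z * evalC (tnth p k) w =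
   \sum_k \sum_(i < r) \sum_(j < r)
     toC ((tnth p k : {poly R})`_i * (tnth p k : {poly R})`_j) * (z ^+ i * w ^+ j).
  apply: eq_bigr => k _; rewrite !(evalC_sum _ (size_npoly _)) big_distrlr /=.
  apply: eq_bigr => i _; apply: eq_bigr => j _.
  by rewrite /toC rmorphM /=; ring.
rewrite [X in _ * X]exchange_big mulr_sumr; apply: eq_bigr => i _ /=.
rewrite [X in _ * X]exchange_big mulr_sumr; apply: eq_bigr => j _ /=.
rewrite -mulr_suml -rmorph_sum /= -/(toC _) !exprS; ring.
Qed.

(** A Cholesky factor U of the coefficient matrix of [g] writes the kernel as the
sum of p_k(z) p_k(w) with p_k the rows of U. *)
Lemma squares_of_kernel (q : {poly R}) (g : nat -> nat -> R) :
  (size q <= r.+1)%N ->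
  (forall i j, (i <= r)%N -> (j <= r)%N ->
    residual_kernel (nth 0 rho) (nth 0 sigma) (nth 0 lambda) (2 * gamma) (nth 0 q) i j
    = shift_kernel r g i j) ->
  posdefmx (\matrix_(i < r, j < r) g i j) ->
  square_repr r rho sigma lambda gamma.
Proof.
move=> sq kerE /cholesky [U Uu GE].
pose p : r.-tuple {poly_r R} := [tuple mk_npoly r (fun i =>
  if insub i is Some o then U k o else 0) | k < r].
have pE k (i : 'I_r) : (tnth p k : {poly R})`_i = U k i.
  by rewrite tnth_mktuple /= coef_poly ltn_ord valK.
exists p, q; split=> //.
  rewrite free_coefmx; suff -> : coefmx p = U by [].
  by apply/matrixP => k i; rewrite mxE pE.
move=> z w.
have e : evalC rho z * evalC sigma w + evalC sigma z * evalC rho w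
     - 2 * toC gamma * evalC lambda z * evalC lambda w - evalC q z * evalC q w
   = \sum_(i < r) \sum_(j < r) toC (g i j)
       * (z ^+ i.+1 * w ^+ j.+1 - z ^+ i * w ^+ j).
  have := @kernel_eval _ _ (real_complex R) r _ _ _ _ _ _ kerE
    (fun i => z ^+ i) (fun i => w ^+ i).
  by rewrite /= !evalC_real_sum ?srho ?ssigma // rmorphM rmorph_nat.
rewrite -sum_gram; transitivity (evalC q z * evalC q w +
    \sum_(i < r) \sum_(j < r) toC (g i j)
       * (z ^+ i.+1 * w ^+ j.+1 - z ^+ i * w ^+ j)); first by rewrite -e; ring.
congr (_ + _); apply: eq_bigr => i _; apply: eq_bigr => j _; congr (toC _ * _).
have := congr1 (fun M : 'M[R]_r => M i j) GE; rewrite !mxE => ->.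
by apply: eq_bigr => k _; rewrite !pE mxE.
Qed.

Lemma matrix_of_squares : square_repr r rho sigma lambda gamma ->
  matrix_repr r rho sigma lambda gamma.
Proof.
move=> [p [q [fp sq H]]].
pose g i j := \sum_(k < r) (tnth p k : {poly R})`_i * (tnth p k : {poly R})`_j.
have kerE i j : (i <= r)%N -> (j <= r)%N ->
    residual_kernel (nth 0 rho) (nth 0 sigma) (nth 0 lambda) (2 * gamma) (nth 0 q) i j
    = shift_kernel r g i j.
  move=> ir jr; apply/eqP; rewrite -subr_eq0; apply/eqP.
  apply: (@coef2_eq0_of_eval R r.+1 (fun i j => residual_kernel (nth 0 rho) (nth 0 sigma)
    (nth 0 lambda) (2 * gamma) (nth 0 q) i j - shift_kernel r g i j)) => // s t.
  apply: complexI; rewrite rmorph_sum rmorph0.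
  transitivity (
     \sum_(i < r.+1) \sum_(j < r.+1) toC (residual_kernel (nth 0 rho) (nth 0 sigma)
       (nth 0 lambda) (2 * gamma) (nth 0 q) i j) * (toC s ^+ i * toC t ^+ j)
   - \sum_(i < r.+1) \sum_(j < r.+1) shift_kernel r (fun i j => toC (g i j)) i j
       * (toC s ^+ i * toC t ^+ j)).
    rewrite -sumrB; apply: eq_bigr => k _; rewrite rmorph_sum -sumrB.
    apply: eq_bigr => m _; rewrite rmorphM rmorphB -mulrBl /= rmorphM !rmorphXn.
    congr ((_ - _) * _); rewrite /shift_kernel rmorphB.
    by do 2 case: ifP => _; rewrite ?rmorph0.
  move: (toC s) (toC t) => z w.
  rewrite sum_shift_kernel sum_gram; move: (H z w); set S := _ * \sum_(k < r) _ => Hzw.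
  rewrite (residual_kernel_sum (real_complex R)) /=.
  rewrite !evalC_real_sum ?srho ?ssigma //.
  have -> : real_complex R (2 * gamma) = 2 * toC gamma by rewrite rmorphM rmorph_nat.
  by rewrite [evalC sigma _ * _]mulrC Hzw; ring.
pose G := \matrix_(k < r, m < r) g (r.-1 - k)%N (r.-1 - m)%N.
exists (coefvec r q), G; split.
  suff -> : G = \matrix_(i, j) ((coefmx p)^T *m coefmx p) (rev_ord i) (rev_ord j).
    by apply/posdef_rev/posdef_gram; rewrite -free_coefmx.
  have re1 (k : 'I_r) : rev_ord k = (r.-1 - k)%N :> nat by case: k => k /= ?; lia.
  apply/matrixP => i j; rewrite !mxE /g; apply: eq_bigr => k _.
  by rewrite !mxE !re1.
apply/matrixP => i j; rewrite [RHS]mxE_addB.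
rewrite (bordered_shift_kernel g) // -kerE ?leq_subr // /residual_kernel !(mxE, big_ord1); ring.
Qed.

Lemma squares_of_matrix : matrix_repr r rho sigma lambda gamma ->
  square_repr r rho sigma lambda gamma.
Proof.
move=> [q [G [Gp E]]].
pose o : 'I_r := Ordinal hr.
pose g i j := G (insubd o (r.-1 - i)%N) (insubd o (r.-1 - j)%N).
pose Q := \poly_(i < r.+1) q (inord (r - i)) 0.
have insR (k : 'I_r) : insubd o (r.-1 - k)%N = rev_ord k.
  apply: val_inj; rewrite val_insubd /=; case: k => k /= kr.
  by rewrite (_ : (r.-1 - k < r)%N = true); clear - kr; lia.
have insK (k : 'I_r) : insubd o (r.-1 - (r.-1 - k))%N = k.
  have {1}-> : (r.-1 - k = rev_ord k)%N by case: k => k /= kr; clear; lia.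
  by rewrite insR rev_ordK.
have GE : G = \matrix_(k < r, m < r) g (r.-1 - k)%N (r.-1 - m)%N.
  by apply/matrixP => i j; rewrite mxE /g !insK.
apply: (@squares_of_kernel Q g); first exact: size_poly.
  move=> i j ir jr.
  have := congr1 (fun M : 'M[R]_r.+1 => M (inord (r - i)) (inord (r - j))) E.
  rewrite [RHS]mxE_addB GE.
  rewrite (bordered_shift_kernel g) // !inordK ?ltnS ?leq_subr // !subKn //.
  rewrite !(mxE, big_ord1) !inordK ?ltnS ?leq_subr // !subKn // => e.
  rewrite /residual_kernel !coef_poly !ltnS ir jr; apply/eqP; rewrite subr_eq [X in _ == X]addrC.
  by rewrite -e; apply/eqP; ring.
have -> : \matrix_(i < r, j < r) g i j = \matrix_(i, j) G (rev_ord i) (rev_ord j).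
  by apply/matrixP => i j; rewrite !mxE /g !insR.
exact: posdef_rev.
Qed.

(** At w = conj z the representation reads
2 Re(rho conj sigma) - 2 gamma |lambda|^2 = |q|^2 + (|z|^2 - 1) sum |p_j|^2,
and the p_j have no common zero because they span the constants. *)
Lemma strict_of_squares : 0 <= gamma -> square_repr r rho sigma lambda gamma ->
  forall z : R[i], 1 < `|z| ->
  'Re (evalC rho z / evalC sigma z)
    > toC gamma * `|evalC lambda z / evalC sigma z| ^+ 2.
Proof.
move=> gamma0 [p [q [fp sq H]]] z z1.
have pos : gamma * cabs (evalC lambda z) ^+ 2 <
    complex.Re (evalC rho z * (evalC sigma z)^*).
  have := H z z^*; rewrite !evalCJ [(evalC rho z)^* * _]mulrC -mulrA -cabs_sqr.
  set X := evalC rho z * _.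
  have -> : evalC sigma z * (evalC rho z)^* = X^* by rewrite rmorphM /= conjCK mulrC.
  rewrite addcJ_Re -cabs_sqr.
  under eq_bigr do rewrite evalCJ -cabs_sqr.
  have -> : z * z^* = toC (cabs z ^+ 2) by rewrite cabs_sqr.
  rewrite -(rmorph_sum (real_complex R)) => e.
  have {}e : 2 * complex.Re X - 2 * gamma * cabs (evalC lambda z) ^+ 2 =
     cabs (evalC q z) ^+ 2 + (cabs z ^+ 2 - 1) *
       \sum_(j < r) cabs (evalC (tnth p j) z) ^+ 2.
    apply: complexI; rewrite !(rmorphB, rmorphD, rmorphM) rmorph1 /=.
    by move: e; rewrite /toC !rmorphM rmorph_nat => ->.
  have zz : 0 < cabs z ^+ 2 - 1.
    by rewrite subr_gt0 exprn_egt1 // -ltcR -/(toC (cabs z)) -cabsE.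
  have S0 : 0 < \sum_(j < r) cabs (evalC (tnth p j) z) ^+ 2.
    rewrite lt_neqAle eq_sym sumr_ge0 ?andbT; last by move=> j _; rewrite sqr_ge0.
    rewrite psumr_eq0; last by move=> j _; rewrite sqr_ge0.
    apply/negP => /allP all0.
    have : map_mx (real_complex R) (coefmx p) *m \col_(i < r) z ^+ i = 0.
      apply/colP => k; rewrite [RHS]mxE mxE.
      have := all0 k (mem_index_enum _); rewrite sqrf_eq0 cabs_eq0 => /eqP pk0.
      rewrite -[RHS]pk0 (evalC_sum _ (size_npoly _)).
      by apply: eq_bigr => i _; rewrite !mxE.
    move=> /(congr1 (mulmx (invmx (map_mx (real_complex R) (coefmx p))))).
    (* The entry of index 0 of the vector of powers of z is 1. *)
    rewrite mulKmx ?map_unitmx -?free_coefmx // mulmx0 => /colP /(_ (Ordinal hr)).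
    by rewrite !mxE expr0 => /eqP; rewrite oner_eq0.
  have := mulr_gt0 zz S0; have := sqr_ge0 (cabs (evalC q z)); lra.
have s0 : evalC sigma z != 0.
  apply: contraTneq pos => ->; rewrite rmorph0 mulr0 -leNgt mulr_ge0 //.
  exact: sqr_ge0.
by rewrite ltC_Re strict_quotient.
Qed.

End Representations.

(** * The cycle of implications *)
Section Implications.
Variables (R : realType) (r : nat) (rho sigma lambda : {poly R}) (gamma : R).
Hypotheses (cop : coprimep rho sigma) (gamma0 : 0 <= gamma).
Local Notation re := (@complex.Re R).

Lemma norm_gt1 (z : R[i]) : (1 < `|z|) = (1 < cabs z).
Proof. by rewrite cabsE -[X in X < _]/(toC 1) ltcR. Qed.

Lemma norm_ge1 (z : R[i]) : (1 <= `|z|) = (1 <= cabs z).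
Proof. by rewrite cabsE -[X in X <= _]/(toC 1) lecR. Qed.

(** A boundary point z is approached along (1 + t) z. *)
Lemma weak_of_strict :
  (forall z : R[i], 1 < `|z| ->
     'Re (evalC rho z / evalC sigma z)
       > toC gamma * `|evalC lambda z / evalC sigma z| ^+ 2) ->
  forall z : R[i], 1 <= `|z| ->
     'Re (evalC rho z * evalC sigma z^*) >= toC gamma * `|evalC lambda z| ^+ 2.
Proof.
move=> strict.
have out z : 1 < cabs z ->
    gamma * cabs (evalC lambda z) ^+ 2 < re (evalC rho z * (evalC sigma z)^*).
  rewrite -norm_gt1 => /strict; rewrite ltC_Re.
  have [->|s0] := eqVneq (evalC sigma z) 0; last by rewrite strict_quotient.
  by rewrite invr0 !mulr0 cabs0 expr0n mulr0 ltxx.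
move=> z; rewrite norm_ge1 evalCJ leC_Re le_eqVlt => /orP[/eqP z1|/out/ltW //].
have [P PE] := horner_ray (polyC_of rho) (polyC_of sigma) z z.
have [Q QE] := horner_ray (polyC_of lambda) (polyC_of lambda) z z.
have val t : re (P - toC gamma *: Q).[toC t] =
    re (evalC rho (z + toC t * z) * (evalC sigma (z + toC t * z))^*)
    - gamma * cabs (evalC lambda (z + toC t * z)) ^+ 2.
  rewrite hornerD hornerN hornerZ PE QE raddfB /= re_toC_mul -!/(evalC _ _).
  by rewrite -cabs_sqr.
have := @re_horner0_ge0 _ (P - toC gamma *: Q) 1 ltr01.
have := val 0; rewrite {1 2 3 4}/toC rmorph0 mul0r addr0 => ->.
rewrite subr_ge0; apply=> t /andP[t0 _]; rewrite val subr_ge0 ltW // out //.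
have -> : z + toC t * z = toC (1 + t) * z.
  by rewrite /toC rmorphD rmorph1 mulrDl mul1r.
by rewrite cabsM cabs_toC -z1 mulr1 gtr0_norm; lra.
Qed.

Lemma boundary_of_weak : sigma != 0 ->
  (forall z : R[i], 1 <= `|z| ->
     'Re (evalC rho z * evalC sigma z^*) >= toC gamma * `|evalC lambda z| ^+ 2) ->
  [/\ forall z : R[i], 1 < `|z| -> evalC sigma z != 0,
      forall z : R[i], `|z| = 1 ->
         'Re (evalC rho z * evalC sigma z^*)
           >= toC gamma * `|evalC lambda z| ^+ 2
    & forall z0 : R[i], root (polyC_of sigma) z0 -> `|z0| = 1 ->
         mup z0 (polyC_of sigma) = 1%N /\
         0 < evalC rho z0 / evalC sigma^`() z0 * z0^*].
Proof.
move=> sigma0 weak.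
have pos z : 1 <= cabs z -> 0 <= re ((polyC_of rho).[z] * ((polyC_of sigma).[z])^*).
  rewrite -norm_ge1 => /weak; rewrite evalCJ leC_Re; apply: le_trans.
  by rewrite mulr_ge0 // sqr_ge0.
have s0 : polyC_of sigma != 0 by rewrite map_poly_eq0.
have copC : coprimep (polyC_of rho) (polyC_of sigma) by rewrite coprimep_map.
split=> [z|z z1|z rz z1]; first by rewrite norm_gt1; apply: no_root_outside copC _.
  by apply: weak; rewrite z1.
have z1' : cabs z = 1 by rewrite /cabs z1.
have [m1 q0] := boundary_root_simple pos s0 copC z1' rz; split=> //.
by move: q0; rewrite [_^`()]deriv_map.
Qed.

Lemma squares_of_boundary :
  size rho = r.+1 -> size sigma = r.+1 -> (size lambda <= r.+1)%N ->
  [/\ forall z : R[i], 1 < `|z| -> evalC sigma z != 0,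
      forall z : R[i], `|z| = 1 ->
         'Re (evalC rho z * evalC sigma z^*)
           >= toC gamma * `|evalC lambda z| ^+ 2
    & forall z0 : R[i], root (polyC_of sigma) z0 -> `|z0| = 1 ->
         mup z0 (polyC_of sigma) = 1%N /\
         0 < evalC rho z0 / evalC sigma^`() z0 * z0^*] ->
  square_repr r rho sigma lambda gamma.
Proof.
move=> srho ssigma slambda [outside circle poles].
have c0 : 0 <= 2 * gamma by rewrite mulr_ge0.
have srho' : (size rho <= r.+1)%N by rewrite srho.
have [|||q sq [D0 psd]] := @boundary_spectral R r rho sigma lambda (2 * gamma)
  srho' ssigma slambda c0 cop.
- by move=> z; rewrite -norm_gt1; apply: outside.
- move=> z /circle; rewrite evalCJ leC_Re => h.
  have -> : evalC sigma z * (evalC rho z)^* = (evalC rho z * (evalC sigma z)^*)^*.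
    by rewrite rmorphM /= conjCK mulrC.
  rewrite addcJ_Re -cabs_sqr /toC -rmorphM lecR; lra.
- by move=> z rz z1; have [] := poles z rz z1.
set h := residual_kernel _ _ _ _ _ in D0 psd.
have hs i j : h i j = h j i by apply: residual_kernel_sym.
have kerE := diagsum_shift_kernel hs D0.
have gs := diagsum_sym hs.
apply: (squares_of_kernel _ _ _ sq kerE) => //.
split; first by apply/matrixP => i j; rewrite !mxE.
move=> x x0; rewrite quad_mxE.
pose y i := if insub i is Some o then x (o : 'I_r) 0 else 0.
have yE (i : 'I_r) : y i = x i 0 by rewrite /y valK.
have -> : \sum_i \sum_j (\matrix_(i, j) diagsum h i j) i j * (x i 0 * x j 0)
   = quad_form r (diagsum h) y.
  by apply: eq_bigr => i _; apply: eq_bigr => j _; rewrite mxE !yE.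
rewrite lt_neqAle eq_sym psd andbT; apply: contraNneq x0 => y0.
apply/eqP/colP => i; rewrite mxE -yE.
exact: (pd_of_psd srho' ssigma slambda sq kerE c0 cop gs psd y0).
Qed.

End Implications.

(* In (i), x / 0 = 0 makes the strict inequality false at a zero of sigma, so   *)
(* (i) entails that both quotients are defined for `|z| > 1.                    *)
Theorem theorem3p1 (R : realType) (r : nat) (rho sigma lambda : {poly R})
    (gamma : R) (hr : (1 <= r)%N)
    (hrho : size rho = r.+1) (hsigma : size sigma = r.+1)
    (hcop : coprimep rho sigma)
    (hlambda0 : lambda != 0) (hlambda : (size lambda <= r.+1)%N)
    (hgamma : 0 <= gamma) :
  [<-> (* (i) *)
       forall z : R[i], 1 < `|z| ->
         'Re (evalC rho z / evalC sigma z)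
           > toC gamma * `|evalC lambda z / evalC sigma z| ^+ 2;
       (* (ii) *)
       forall z : R[i], 1 <= `|z| ->
         'Re (evalC rho z * evalC sigma z^*)
           >= toC gamma * `|evalC lambda z| ^+ 2;
       (* (iii) *)
       [/\ forall z : R[i], 1 < `|z| -> evalC sigma z != 0,
           forall z : R[i], `|z| = 1 ->
             'Re (evalC rho z * evalC sigma z^*)
               >= toC gamma * `|evalC lambda z| ^+ 2
         & forall z0 : R[i], root (polyC_of sigma) z0 -> `|z0| = 1 ->
             mup z0 (polyC_of sigma) = 1%N /\
             0 < evalC rho z0 / evalC sigma^`() z0 * z0^*];
       (* (iv) *)
       exists (p : r.-tuple {poly_r R}) (q : {poly R}),
         [/\ free p, (size q <= r.+1)%N
           & forall z w : R[i],
               evalC rho z * evalC sigma w + evalC rho w * evalC sigma z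
                 - 2 * toC gamma * evalC lambda z * evalC lambda w
               = evalC q z * evalC q w
                 + (z * w - 1) * \sum_(j < r)
                     evalC (tnth p j) z * evalC (tnth p j) w];
       (* (v) *)
       exists (q : 'cV[R]_r.+1) (G : 'M[R]_r),
         posdefmx G /\
         coefvec r rho *m (coefvec r sigma)^T
           + coefvec r sigma *m (coefvec r rho)^T
           - (2 * gamma) *: (coefvec r lambda *m (coefvec r lambda)^T)
         = q *m q^T + bordered_br G - bordered_ul G].
Proof.
have sigma0 : sigma != 0 by rewrite -size_poly_eq0 hsigma.
tfae.
- exact: weak_of_strict.
- exact: (boundary_of_weak hcop hgamma sigma0).
- exact: (squares_of_boundary hcop hgamma hrho hsigma hlambda).
- exact: (matrix_of_squares hr hrho hsigma hlambda).
- by move=> /(squares_of_matrix hr hrho hsigma hlambda); apply: strict_of_squares.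
Qed.
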